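(* Let $\mathbb B$ be a nontrivial geodesic ball in $\mathbb{CP}^1$ (with respect to the Fubini–Study metric) with $\mathrm{Vol}(\mathbb B)\in\,]0,1]$. Then, for $p\in\mathbb N_{>0}$, $$\min\mathrm{Spec}(T_{\boldsymbol 1_{\mathbb B},p})=\mathrm{Vol}(\mathbb B)^{p+1}.$$ In particular, if $\mathrm{Vol}(\mathbb B)<1$, then $\min\mathrm{Spec}(T_{\boldsymbol 1_{\mathbb B},p})$ decays exponentially to $0$ as $p\to+\infty$.
   Context: In the standard chart $\mathbb C\subset\mathbb{CP}^1$ with coordinate $z$, the volume form is the Fubini–Study form $\omega_{\mathrm{FS}}=\frac{\sqrt{-1}}{2\pi}\frac{dz\wedge d\bar z}{(1+|z|^2)^2}$ (total volume $1$), $\mathrm{Vol}$ is the corresponding volume, and geodesic balls are taken with respect to the associated Riemannian metric. $\boldsymbol 1_{\mathbb B}$ is the indicator function of $\mathbb B$. $\mathscr O(p)=\mathscr O(1)^{\otimes p}$ carries the metric induced by the Fubini–Study metric on $\mathscr O(1)$; in the chart, holomorphic sections of $\mathscr O(p)$ are polynomials $s(z)$ of degree $\le p$ with pointwise norm $|s(z)|^2/(1+|z|^2)^p$, and the $\mathcal L^2$-inner product on sections is obtained by integrating against $\omega_{\mathrm{FS}}$. For a bounded measurable function $f$, $T_{f,p}:=P_pM_f$ on $H^0(\mathbb{CP}^1,\mathscr O(p))$, where $M_f$ is multiplication by $f$ and $P_p$ is the orthogonal projection from $\mathcal L^2$ sections of $\mathscr O(p)$ onto $H^0(\mathbb{CP}^1,\mathscr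 O(p))$; $\mathrm{Spec}$ is its set of eigenvalues. *)

(* Defs.v *)
From mathcomp Require Import all_boot all_order all_algebra.
From mathcomp Require Import complex.
From mathcomp Require Import all_classical all_reals all_analysis.
Set Implicit Arguments.
Unset Strict Implicit.
Unset Printing Implicit Defensive.
Import Order.TTheory GRing.Theory Num.Theory.
Import numFieldNormedType.Exports.
Local Open Scope classical_set_scope.
Local Open Scope complex_scope.
Local Open Scope ring_scope.

Definition sqmod (R : realType) (z : R[i]) : R :=
  complex.Re z ^+ 2 + complex.Im z ^+ 2.

(* [Some z] is the point [1 : z] of the standard chart, [None] is the point
   at infinity [0 : 1]. *)
Definition CP1 (R : realType) := option R[i].

(* The point [u0 : u1]; meaningful only for (u0, u1) != (0, 0). *)
Definition homog (R : realType) (u0 u1 : R[i]) : CP1 R :=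
  if u0 == 0 then None else Some (u1 / u0).

(* Since dz /\ dzbar = -2i dx /\ dy, the form
   i/(2 pi) dz /\ dzbar / (1 + |z|^2)^2 is the following multiple of
   dx /\ dy. *)
Definition fs_density (R : realType) (z : R[i]) : R :=
  (pi * (1 + sqmod z) ^+ 2)^-1.

(* The integrals over CP^1 are computed in the chart, the complement of which
   is a single point. *)
Definition fs_int (R : realType) (f : R[i] -> R) : R :=
  \int[(@lebesgue_measure R \x @lebesgue_measure R)%E]_(w in [set: R * R])
    (f (w.1 +i* w.2) * fs_density (w.1 +i* w.2)).

Definition fs_cint (R : realType) (f : R[i] -> R[i]) : R[i] :=
  fs_int (fun z => complex.Re (f z)) +i* fs_int (fun z => complex.Im (f z)).

Definition fs_vol (R : realType) (B : set (CP1 R)) : R :=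
  fs_int (fun z => \1_B (Some z)).

Definition C1_curve (R : realType) (u : R -> R[i]) : Prop :=
  [/\ forall t, derivable (fun s => complex.Re (u s)) t 1,
      forall t, derivable (fun s => complex.Im (u s)) t 1,
      continuous (derive1 (fun s => complex.Re (u s))) &
      continuous (derive1 (fun s => complex.Im (u s)))].

Definition velocity (R : realType) (u : R -> R[i]) (t : R) : R[i] :=
  derive1 (fun s => complex.Re (u s)) t +i*
  derive1 (fun s => complex.Im (u s)) t.

(* The Riemannian metric associated with the volume form is
   |dz|^2 / (pi (1 + |z|^2)^2).  For the curve z = u1 / u0 one has
   z' = (u0 u1' - u1 u0') / u0^2, so that |z'| / (sqrt pi (1 + |z|^2)) is the
   expression below, which moreover is symmetric in (u0, u1) and hence also
   gives the metric near infinity, in the chart 1 / z. *)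
Definition fs_speed (R : realType) (u0 u1 : R -> R[i]) (t : R) : R :=
  Num.sqrt (sqmod (u0 t * velocity u1 t - u1 t * velocity u0 t)) /
  (Num.sqrt pi * (sqmod (u0 t) + sqmod (u1 t))).

Definition fs_length (R : realType) (u0 u1 : R -> R[i]) : R :=
  \int[@lebesgue_measure R]_(t in `[0, 1]) fs_speed u0 u1 t.

(* Every C^1 curve [0, 1] -> CP^1 is of the form t |-> [u0 t : u1 t] for a C^1
   curve (u0, u1) in C^2 minus the origin; curves on [0, 1] are represented by
   C^1 extensions to the real line. *)
Definition curve_from_to (R : realType) (x y : CP1 R) (u0 u1 : R -> R[i]) :
    Prop :=
  [/\ C1_curve u0, C1_curve u1,
      forall t, 0 <= t <= 1 -> (u0 t, u1 t) != (0, 0),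
      homog (u0 0) (u1 0) = x & homog (u0 1) (u1 1) = y].

Definition fs_dist (R : realType) (x y : CP1 R) : R :=
  inf [set l | exists u0 u1 : R -> R[i],
                 curve_from_to x y u0 u1 /\ l = fs_length u0 u1].

Definition geodesic_ball (R : realType) (B : set (CP1 R)) : Prop :=
  exists (c : CP1 R) (r : R), 0 < r /\ B = [set x | fs_dist c x < r].

(* Sections of O(p) are given by their expression in the chart; the
   holomorphic ones are the polynomials of degree at most p, that is, of
   size at most p + 1. *)
Definition H0 (R : realType) (p : nat) := {poly_p.+1 R[i]}.

Definition l2_inner (R : realType) (p : nat) (s t : R[i] -> R[i]) : R[i] :=
  fs_cint (fun z => s z * conjc (t z) / (((1 + sqmod z) ^+ p)%:C)).

(* For s in L^2, this is the unique holomorphic section h such that s - h is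
   orthogonal to all holomorphic sections (the value is junk otherwise). *)
Definition bergman_proj (R : realType) (p : nat) (s : R[i] -> R[i]) : H0 R p :=
  xget 0 [set h : H0 R p | forall q : H0 R p,
    l2_inner p (fun z => s z - (val h).[z]) (fun z => (val q).[z]) = 0].

Definition toeplitz (R : realType) (p : nat) (f : CP1 R -> R[i])
    (q : H0 R p) : H0 R p :=
  bergman_proj p (fun z => f (Some z) * (val q).[z]).

Definition spec (R : realType) (p : nat) (T : H0 R p -> H0 R p) : set R[i] :=
  [set l | exists2 q : H0 R p, q != 0 & T q = l *: q].

(* The order of R[i] is partial: x <= y requires Im x = Im y.  So a set with a
   real minimum consists of real numbers. *)
Definition is_min (R : realType) (S : set R[i]) (m : R[i]) : Prop :=
  S m /\ forall l, S l -> m <= l.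

Definition exp_decay (R : realType) (m : nat -> R) : Prop :=
  exists C a : R, [/\ 0 < C, 0 < a &
    forall p : nat, (0 < p)%N -> `|m p| <= C * expR (- (a * p%:R))].

(* Main.v *)
(** The map (u, v) |-> v / u from C^2 to CP^1 pushes Lebesgue measure on a ball
forward to a multiple of the Fubini-Study measure, which is therefore invariant
under the unitary group.  Under this measure |z|^2 / (1 + |z|^2) is uniformly
distributed on [0, 1].

A geodesic ball centred at [a : b] is a set {x | J (sdist a b x)}, where J is an
initial segment of [0, 1] with supremum v and [sdist] is the squared sine of the
Hermitian angle to [a : b]: a curve from the centre to x can be stopped where it
reaches the level of y and rotated about the centre so as to end at y, whence
[sdist a b y <= sdist a b x] implies that y is at least as close to the centre
as x.

Moving the centre to 0, the Toeplitz operator becomes diagonal in the monomials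
z^k, with eigenvalue the quotient of the integrals of s^k (1 - s)^(p - k) over
[0, v] and [0, 1].  Substituting s = v t and using 1 - v t >= v (1 - t), this is
at least v^(p + 1), with equality for k = p; and k = 0, p = 0 gives the volume. *)
From HB Require Import structures.
Require Import Defs.
From mathcomp Require Import all_boot all_order all_algebra.
From mathcomp Require Import complex.
From mathcomp Require Import all_classical all_reals all_analysis.
From mathcomp Require Import measurable_realfun ring lra.
Set Implicit Arguments.
Unset Strict Implicit.
Unset Printing Implicit Defensive.
Import Order.TTheory GRing.Theory Num.Theory.
Import numFieldNormedType.Exports.
Local Open Scope classical_set_scope.
Local Open Scope complex_scope.
Local Open Scope ring_scope.

(** Every change of variables is reduced to affine substitutions on the line. Multiplication by a
    complex number splits into two triangular real maps, and a multiple of a unitary map of C^2 into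
    two triangular complex ones, each handled by Tonelli. Polar coordinates are replaced by
    comparing image measures on the rays []-oo, x[], and integration over the angle by a single
    rotation under which an off-diagonal moment changes sign.

    The operator itself is never conjugated. The plain Hermitian form and the one weighted by the
    indicator become diagonal in the same transformed coefficients. An eigenvalue is the quotient of
    the two forms at its eigenvector, hence a weighted mean of quotients of moments; a bound on
    these quotients and one explicit eigenvector give the minimum.

    No formula for the distance is established, only its monotonicity in [sdist]. This is why a ball
    is known through a segment whose endpoint may or may not belong to it, and why endpoints are
    treated throughout as null sets. *)

Definition image_measure d1 d2 (T1 : measurableType d1) (T2 : measurableType d2)
    (R : realType) (m : {measure set T1 -> \bar R}) (f : T1 -> T2)
    (mf : measurable_fun [set: T1] f) : {measure set T2 -> \bar R} :=
  measure_function_pushforward__canonical__measure_function_Measure m mf.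
Arguments image_measure {d1 d2 T1 T2 R} m {f} mf.

(** * Integration over the plane *)

Section affine.
Context (R : realType).
Local Notation mu := (@lebesgue_measure R).
Local Open Scope ereal_scope.

Lemma measurable_affine (a b : R) :
  measurable_fun [set: R] (fun x : R => a * x + b)%R.
Proof.
by apply: continuous_measurable_fun => x; apply: cvgD; [exact: mulrl_continuous|exact: cvg_cst].
Qed.

(** Both sides are measures in [A], so uniqueness of Lebesgue measure leaves only half-open
    intervals. For negative [a] the preimage is half-open on the other side, with the same
    length. *)
Lemma lebesgue_measure_affine (a b : R) (A : set R) : a != 0%R ->
  measurable A ->
  mu A = `|a|%R%:E * mu ((fun x => (a * x + b)%R) @^-1` A).
Proof.
move=> a0 mA.
pose f x : R := (a * x + b)%R.
have mf : measurable_fun [set: measurableTypeR R] (f : measurableTypeR R -> measurableTypeR R).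
  exact: measurable_affine.
pose m : {measure set (measurableTypeR R) -> \bar R} :=
  [the {measure set _ -> \bar R} of mscale (NngNum (normr_ge0 a)) (image_measure mu mf)].
rewrite (_ : _ * _ = m A)//.
apply: lebesgue_measure_unique => // _ [[c d]] _ <- /=.
rewrite /mscale/= /pushforward.
have [a_gt0|a_lt0] : (0 < a \/ a < 0)%R by apply/orP; rewrite orbC -neq_lt.
- rewrite (_ : f @^-1` `]c, d]%classic = `]((c - b) / a)%R, ((d - b) / a)%R]%classic).
    rewrite !lebesgue_measure_itv/= !lte_fin ltr_pM2r ?invr_gt0// ltrD2r gtr0_norm//.
    by case: ifPn => _; rewrite ?mule0// -EFinM; congr EFin; field.
  apply/seteqP; split => x /=; rewrite !in_itv/= ltr_pdivrMr// ler_pdivlMr//.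
    by rewrite /f (mulrC a) ltrBlDr lerBrDr.
  by rewrite /f (mulrC a) ltrBlDr lerBrDr.
- rewrite (_ : f @^-1` `]c, d]%classic = `[((d - b) / a)%R, ((c - b) / a)%R[%classic).
    rewrite !lebesgue_measure_itv/= !lte_fin ltr_nM2r ?invr_lt0// ltrD2r ltr0_norm//.
    by case: ifPn => _; rewrite ?mule0// -EFinM; congr EFin; field.
  apply/seteqP; split => x /=; rewrite !in_itv/= ltr_ndivlMr// ler_ndivrMr//.
    by rewrite /f (mulrC a) ltrBlDr lerBrDr andbC.
  by rewrite /f (mulrC a) ltrBlDr lerBrDr andbC.
Qed.

Lemma ge0_integral_affine (a b : R) (f : R -> \bar R) : a != 0%R ->
  measurable_fun [set: R] f -> (forall x, 0 <= f x) ->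
  \int[mu]_x f x = `|a|%R%:E * \int[mu]_x f (a * x + b)%R.
Proof.
move=> a0 mf f0.
pose g x : R := (a * x + b)%R.
have mg : measurable_fun [set: measurableTypeR R] (g : measurableTypeR R -> measurableTypeR R).
  exact: measurable_affine.
pose m : {measure set (measurableTypeR R) -> \bar R} :=
  [the {measure set _ -> \bar R} of mscale (NngNum (normr_ge0 a)) (image_measure mu mg)].
transitivity (\int[m]_x f x).
  by apply: eq_measure_integral => A mA _; exact: lebesgue_measure_affine.
rewrite ge0_integral_mscale//; congr (_ * _).
by rewrite ge0_integral_pushforward// => x _.
Qed.
End affine.

Section cplane.
Context (R : realType).
Local Notation mu := (@lebesgue_measure R).
Local Notation mu2 := (@lebesgue_measure R \x @lebesgue_measure R)%E.

Definition cplx (w : R * R) : R[i] := w.1 +i* w.2.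
Definition pt (z : R[i]) : R * R := (complex.Re z, complex.Im z).

Lemma ptK : cancel pt cplx. Proof. by case. Qed.
Lemma cplxK : cancel cplx pt. Proof. by case. Qed.

Lemma sqmodM (z w : R[i]) : sqmod (z * w) = sqmod z * sqmod w.
Proof. by case: z w => a b [c d]; rewrite /sqmod/=; ring. Qed.

Lemma sqmod0 : sqmod (0 : R[i]) = 0.
Proof. by rewrite /sqmod/= expr0n/= addr0. Qed.

Lemma sqmodN (z : R[i]) : sqmod (- z) = sqmod z.
Proof. by case: z => a b; rewrite /sqmod/= !sqrrN. Qed.

Lemma sqmodJ (z : R[i]) : sqmod (conjc z) = sqmod z.
Proof. by case: z => a b; rewrite /sqmod/= sqrrN. Qed.

Lemma sqmod_real (x : R) : sqmod x%:C = x ^+ 2.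
Proof. by rewrite /sqmod/= expr0n/= addr0. Qed.

Lemma sqmod_divK (k : R) (a : R[i]) : a != 0 ->
  sqmod (k%:C / a) * sqmod a = k ^+ 2.
Proof. by move=> a0; rewrite -sqmodM divfK// sqmod_real. Qed.

Lemma mul_conjc (z : R[i]) : z * conjc z = (sqmod z)%:C.
Proof.
case: z => x y; apply/eqP; rewrite eq_complex/=; apply/andP; split; apply/eqP.
  by rewrite /sqmod/=; ring.
by ring.
Qed.

Lemma sqmod_ge0 (z : R[i]) : 0 <= sqmod z.
Proof. by rewrite addr_ge0// sqr_ge0. Qed.

Lemma sqmod_eq0 (z : R[i]) : (sqmod z == 0) = (z == 0).
Proof.
by case: z => a b; rewrite paddr_eq0 ?sqr_ge0// !sqrf_eq0 eq_complex.
Qed.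

Lemma sqmod_gt0 (z : R[i]) : (0 < sqmod z) = (z != 0).
Proof. by rewrite lt_neqAle eq_sym sqmod_eq0 sqmod_ge0 andbT. Qed.

Local Open Scope ereal_scope.

Lemma ge0_integral_prod (F : R * R -> \bar R) : measurable_fun [set: R * R] F ->
  (forall w, 0 <= F w) -> \int[mu2]_w F w = \int[mu]_x \int[mu]_y F (x, y).
Proof. by move=> mF F0; rewrite fubini_tonelli1. Qed.

Lemma ge0_integral_swap (F : R * R -> \bar R) : measurable_fun [set: R * R] F ->
  (forall w, 0 <= F w) ->
  \int[mu]_x \int[mu]_y F (x, y) = \int[mu]_y \int[mu]_x F (x, y).
Proof. by move=> mF F0; rewrite (fubini_tonelli (m1 := mu) (m2 := mu)). Qed.

Lemma measurable_ge0_integral1 (F : R * R -> \bar R) : measurable_fun [set: R * R] F ->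
  (forall w, 0 <= F w) -> measurable_fun [set: R] (fun x => \int[mu]_y F (x, y)).
Proof. by move=> mF F0; exact: (measurable_fun_fubini_tonelli_F (m2 := mu)). Qed.

Lemma measurable_ge0_integral2 (F : R * R -> \bar R) : measurable_fun [set: R * R] F ->
  (forall w, 0 <= F w) -> measurable_fun [set: R] (fun y => \int[mu]_x F (x, y)).
Proof. by move=> mF F0; exact: (measurable_fun_fubini_tonelli_G (m1 := mu)). Qed.

(** When [a != 0], the real matrix of multiplication by [a +i* b] is a product of two triangular
    ones: first [x' = a x - b y] at fixed [y], then [y' = e y + (b / a) x'] at fixed [x']. The
    Jacobians [a] and [e] multiply to [a ^+ 2 + b ^+ 2]. *)
Let ge0_integral_cmul_Re (a b : R) (v : R[i]) (G : R * R -> \bar R) : a != 0%R ->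
    measurable_fun [set: R * R] G -> (forall w, 0 <= G w) ->
    \int[mu2]_w G w =
    (sqmod (a +i* b))%:E * \int[mu2]_w G (pt ((a +i* b) * cplx w + v)%R).
Proof.
move=> a0 mG G0; case: v => c d.
have m1 : measurable_fun [set: R * R] (fst : R * R -> R) by exact: measurable_fst.
have m2 : measurable_fun [set: R * R] (snd : R * R -> R) by exact: measurable_snd.
pose e := ((a ^+ 2 + b ^+ 2) / a)%R.
have s_gt0 : (0 < a ^+ 2 + b ^+ 2)%R.
  by rewrite ltr_wpDr ?sqr_ge0// lt_neqAle eq_sym sqrf_eq0 a0 sqr_ge0.
have e0 : (e != 0)%R by rewrite mulf_neq0 ?invr_eq0// gt_eqF.
pose G1 (w : R * R) := G (w.1, e * w.2 + ((b / a) * (w.1 - c) + d))%R.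
have mG1 : measurable_fun [set: R * R] G1.
  apply: measurableT_comp => //; apply: measurable_fun_pair => //.
  apply: measurable_funD; first by apply: measurable_funM.
  apply: measurable_funD => //; apply: measurable_funM => //.
  exact: measurable_funB.
have G10 w : 0 <= G1 w by exact: G0.
pose G2 (w : R * R) := G1 (a * w.1 + (c - b * w.2), w.2)%R.
have mG2 : measurable_fun [set: R * R] G2.
  apply: measurableT_comp => //; apply: measurable_fun_pair => //.
  apply: measurable_funD; first by apply: measurable_funM.
  by apply: measurable_funB => //; exact: measurable_funM.
have G20 w : 0 <= G2 w by exact: G0.
rewrite ge0_integral_prod//.
transitivity (\int[mu]_x (`|e|%R%:E * \int[mu]_y G1 (x, y))).
  apply: eq_integral => x _.
  by rewrite (ge0_integral_affine ((b / a) * (x - c) + d)%R e0)//; exact: measurableT_comp.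
rewrite ge0_integralZl//=; first last.
- by move=> x _; apply: integral_ge0 => y _; exact: G0.
- by apply: measurable_ge0_integral1.
rewrite ge0_integral_swap//.
transitivity (`|e|%R%:E * \int[mu]_y (`|a|%R%:E * \int[mu]_x G2 (x, y))).
  congr (_ * _); apply: eq_integral => y _.
  by rewrite (ge0_integral_affine (c - b * y)%R a0)//; exact: measurableT_comp.
rewrite ge0_integralZl//=; first last.
- by move=> x _; apply: integral_ge0 => y _; exact: G0.
- by apply: measurable_ge0_integral2.
rewrite -ge0_integral_swap// -ge0_integral_prod// muleA -EFinM -normrM.
rewrite divfK// ger0_norm ?ltW//; congr (_ * _).
apply: eq_integral => -[x y] _; rewrite /G2 /G1/=; congr G.
by rewrite /pt /=; congr pair; rewrite /e; field.
Qed.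

Lemma ge0_integral_cmul (u v : R[i]) (F : R * R -> \bar R) : u != 0%R ->
  measurable_fun [set: R * R] F -> (forall w, 0 <= F w) ->
  \int[mu2]_w F w = (sqmod u)%:E * \int[mu2]_w F (pt (u * cplx w + v)%R).
Proof.
case: u => a b u0 mF F0.
have [a0|a0] := eqVneq a 0%R; last exact: ge0_integral_cmul_Re.
have b0 : b != 0%R by move: u0; rewrite eq_complex/= a0 eqxx.
have m1 : measurable_fun [set: R * R] (fst : R * R -> R) by exact: measurable_fst.
have m2 : measurable_fun [set: R * R] (snd : R * R -> R) by exact: measurable_snd.
have mF1 : measurable_fun [set: R * R] (fun w => F (pt ((1 +i* 1) * cplx w + v)%R)).
  apply: measurableT_comp => //; case: v => c d; apply: measurable_fun_pair => //=.
    apply: measurable_funD => //; apply: measurable_funB; exact: measurable_funM.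
  apply: measurable_funD => //; apply: measurable_funD; exact: measurable_funM.
(* Since [(1 + i)^2 = 2 i], the multiplier [b i] is the product of [1 + i] and [(b / 2) (1 + i)],
   whose real parts do not vanish. *)
rewrite (@ge0_integral_cmul_Re 1 1 v)// ?oner_eq0//.
rewrite (@ge0_integral_cmul_Re (b / 2) (b / 2) 0)%R//; last by rewrite mulf_neq0.
rewrite muleA -EFinM; congr (_%:E * _).
  by rewrite a0 /sqmod/=; field.
apply: eq_integral => -[x y] _; congr (F (pt (_ + _)%R)).
rewrite ptK a0 /cplx/= addr0 mulrA; congr (_ * _)%R.
by apply/eqP; rewrite eq_complex/=; apply/andP; split; apply/eqP; field.
Qed.
End cplane.

(** * Measures given by a density *)

Section density.
Local Open Scope ereal_scope.
Context d (T : measurableType d) (R : realType) (mu : {measure set T -> \bar R}).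
Variable f : T -> R.
Hypothesis mf : measurable_fun [set: T] f.
Hypothesis f0 : forall x, (0 <= f x)%R.

(** The two proofs are arguments so that the measure structure can be attached to the term
    itself. *)
Definition density of measurable_fun [set: T] f & (forall x, 0 <= f x)%R :=
  fun A : set T => \int[mu]_(x in A) (f x)%:E.

Local Notation df := (density mf f0).

Let density0 : df set0 = 0.
Proof. by rewrite /density integral_set0. Qed.

Let density_ge0 A : 0 <= df A.
Proof. by apply: integral_ge0 => x _; rewrite lee_fin. Qed.

Let density_sigma_additive : semi_sigma_additive df.
Proof.
move=> A mA tA mUA; rewrite /density ge0_integral_bigcup//; first last.
- by move=> x _; rewrite lee_fin.
- by apply/measurable_EFinP; exact: measurable_funTS.
by apply: is_cvg_ereal_nneg_natsum_cond => n _ _; exact: density_ge0.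
Qed.

HB.instance Definition _ := isMeasure.Build _ _ _ df
  density0 density_ge0 density_sigma_additive.

Import HBNNSimple.

Lemma ge0_integral_density (F : T -> \bar R) : measurable_fun [set: T] F ->
  (forall x, 0 <= F x) -> \int[df]_x F x = \int[mu]_x (F x * (f x)%:E).
Proof.
move=> mF F0; pose h := nnsfun_approx measurableT mF.
have mEf : measurable_fun [set: T] (EFin \o f) by exact/measurable_EFinP.
have -> : \int[df]_x F x = limn (fun n => \int[df]_x (h n x)%:E).
  rewrite -monotone_convergence//=.
  - by apply: eq_integral => x _; apply/esym/cvg_lim => //; exact: cvg_nnsfun_approx.
  - by move=> n; apply/measurable_EFinP.
  - by move=> n x _; rewrite lee_fin.
  - by move=> x _ a b ab; rewrite lee_fin//; exact/lefP/nd_nnsfun_approx.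
have -> : \int[mu]_x (F x * (f x)%:E) = limn (fun n => \int[mu]_x ((h n x)%:E * (f x)%:E)).
  rewrite -monotone_convergence//=.
  - apply: eq_integral => x _; apply/esym/cvg_lim => //; apply: cvgeZr => //.
    exact: cvg_nnsfun_approx.
  - by move=> n; apply: emeasurable_funM => //; apply/measurable_EFinP.
  - by move=> n x _; rewrite mule_ge0// lee_fin.
  - move=> x _ a b ab; rewrite lee_wpmul2r ?lee_fin//; exact/lefP/nd_nnsfun_approx.
congr (limn _); apply/funext => n.
under [LHS]eq_integral do rewrite fimfunE -fsumEFin//.
rewrite ge0_integral_fsum//; last 2 first.
- by move=> y; exact/measurable_EFinP/measurable_funM.
- by move=> y x _; rewrite nnfun_muleindic_ge0.
under [RHS]eq_integral.
  move=> x _; rewrite fimfunE -fsumEFin// ge0_mule_fsuml; last first.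
    by move=> y; exact: nnfun_muleindic_ge0.
  over.
rewrite [RHS]ge0_integral_fsum//; first last.
- by move=> y x _; rewrite mule_ge0 ?lee_fin// -lee_fin EFinM nnfun_muleindic_ge0.
- move=> y; apply: emeasurable_funM => //; exact/measurable_EFinP/measurable_funM.
apply: eq_fsbigr => r _; rewrite integralZl_indic_nnsfun// integral_indic// setIT.
have [r0|r0] := leP 0%R r; last first.
  rewrite preimage_nnfun0// measure0 mule0.
  by rewrite integral0_eq// => x _; rewrite indic0 mulr0 mul0e.
under eq_integral do rewrite EFinM -muleA.
rewrite ge0_integralZl ?lee_fin//; first last.
- by move=> x _; rewrite mule_ge0// lee_fin.
- by apply: emeasurable_funM => //; exact/measurable_EFinP.
congr (_ * _); rewrite /= /density integral_mkcond.
apply: eq_integral => x _; rewrite patchE indicE.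
by case: ifPn => xr; rewrite ?mul1e ?mul0e.
Qed.

End density.

Lemma eq_integral_outside d (T : measurableType d) (R : realType)
    (mu : {measure set T -> \bar R}) (N : set T) (f g : T -> \bar R) :
  measurable N -> mu N = 0%E ->
  measurable_fun [set: T] f -> measurable_fun [set: T] g ->
  (forall x, ~ N x -> f x = g x) ->
  (\int[mu]_x f x = \int[mu]_x g x)%E.
Proof.
move=> mN N0 mf mg fg; apply: ae_eq_integral => //.
exists N; split => // x /= /not_implyP[_ fgx].
by apply: contrapT => /fg.
Qed.

(** * Integration of radial functions on the plane *)

Section radial.
Context (R : realType).
Local Notation mu := (@lebesgue_measure R).
Local Notation mu2 := (@lebesgue_measure R \x @lebesgue_measure R)%E.

Definition sq (w : R * R) : R := w.1 ^+ 2 + w.2 ^+ 2.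

Lemma sq_ge0 w : 0 <= sq w. Proof. by rewrite addr_ge0// sqr_ge0. Qed.

Lemma sqE w : sq w = sqmod (cplx w). Proof. by []. Qed.
Lemma sq_pt z : sq (pt z) = sqmod z. Proof. by []. Qed.

Lemma sq_eq0 w : (sq w == 0) = (w == (0, 0)).
Proof. by case: w => x y; rewrite paddr_eq0 ?sqr_ge0// !sqrf_eq0. Qed.

Lemma measurable_sq : measurable_fun [set: R * R] sq.
Proof.
by apply: measurable_funD; apply: measurable_funX; [exact: measurable_fst|exact: measurable_snd].
Qed.

Lemma measurable_sublevel d (T : measurableType d) (f : T -> R) (c : R) :
  measurable_fun [set: T] f -> measurable [set x | (f x < c)%R].
Proof.
move=> mf; rewrite (_ : [set x | _] = setT `&` f @^-1` `]-oo, c[%classic).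
  by apply: mf => //; exact: measurable_itv.
by rewrite setTI; apply/seteqP; split => x /=; rewrite in_itv.
Qed.

Local Open Scope ereal_scope.

Lemma measurable_point (w : R * R) : measurable [set w].
Proof.
case: w => x y; rewrite (_ : [set (x, y)] = [set x] `*` [set y]).
  by apply: measurableX; exact: measurable_set1.
by apply/seteqP; split => [[a b] /= [-> ->]//|[a b] /= [-> ->]].
Qed.

Lemma lebesgue_measure2_point (w : R * R) : mu2 [set w] = 0.
Proof.
case: w => x y; rewrite (_ : [set (x, y)] = [set x] `*` [set y]).
  transitivity (mu [set x] * mu [set y]); first exact: product_measure1E.
  by rewrite !lebesgue_measure_set1 mule0.
by apply/seteqP; split => [[a b] /= [-> ->]//|[a b] /= [-> ->]].
Qed.

Definition disc (c : R) : set (R * R) := [set w | (sq w < c)%R].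

Lemma measurable_disc c : measurable (disc c).
Proof. by apply: measurable_sublevel; exact: measurable_sq. Qed.

Let disc_integral c : mu2 (disc c) = \int[mu2]_w (\1_(disc c) w)%:E.
Proof. by rewrite integral_indic ?setIT//; exact: measurable_disc. Qed.

Lemma disc_scale (c : R) : (0 < c)%R -> mu2 (disc c) = c%:E * mu2 (disc 1).
Proof.
move=> c0; have c1 : (c^-1 != 0)%R by rewrite invr_eq0 gt_eqF.
have s0 : (Num.sqrt c)%:C != 0%R.
  by rewrite eq_complex/= eqxx andbT gt_eqF// sqrtr_gt0.
rewrite !disc_integral (ge0_integral_cmul 0%R s0)//; last first.
  by apply/measurable_EFinP/measurable_indic; exact: measurable_disc.
congr (_ * _).
  by rewrite /sqmod/= expr0n/= addr0 sqr_sqrtr// ltW.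
apply: eq_integral => w _; rewrite !indicE; congr ((_ : bool)%:R%:E).
apply/idP/idP; rewrite !inE /disc/= addr0 sq_pt sqmodM -sqE /sqmod/= expr0n/= addr0 sqr_sqrtr ?ltW//.
  by rewrite -[X in (_ < X)%R -> _](mulr1 c) ltr_pM2l.
by rewrite -[X in _ -> (_ < X)%R](mulr1 c) ltr_pM2l.
Qed.

Lemma disc1_lty : mu2 (disc 1) < +oo.
Proof.
apply: (@le_lt_trans _ _ (mu2 (`[(-1)%R, 1%R] `*` `[(-1)%R, 1%R]))).
  apply: le_measure; rewrite ?inE.
  - exact: measurable_disc.
  - by apply: measurableX; exact: measurable_itv.
  - move=> [x y] /=; rewrite /disc /sq /= !in_itv/= => xy.
    have x2 := sqr_ge0 x; have y2 := sqr_ge0 y.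
    by split; rewrite -ler_norml -(@ler_pXn2r _ 2%N) ?nnegrE// expr1n real_normK ?num_real//; lra.
apply: (@le_lt_trans _ _ (mu `[(-1)%R, 1%R] * mu `[(-1)%R, 1%R])).
  by rewrite -product_measure1E//; exact: measurable_itv.
by rewrite !lebesgue_measure_itv/= lte_fin; case: ifP; rewrite -EFinM ltry.
Qed.

Lemma disc_le0 (c : R) : (c <= 0)%R -> mu2 (disc c) = 0.
Proof.
move=> c0; rewrite (_ : disc c = set0) ?measure0//.
apply/seteqP; split => // w; rewrite /disc/= ltNge => /negP; apply.
exact: le_trans (sq_ge0 w).
Qed.

Let A1 := fine (mu2 (disc 1)).

Let A1E : mu2 (disc 1) = A1%:E.
Proof. by rewrite fineK// ge0_fin_numE// disc1_lty. Qed.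

Let A1_ge0 : (0 <= A1)%R. Proof. exact: fine_ge0. Qed.

Let dn (s : R) : R := (A1 * \1_(`[0%R, +oo[%classic) s)%R.

Let mdn : measurable_fun [set: R] dn.
Proof. by apply: measurable_funM => //; apply: measurable_indic; exact: measurable_itv. Qed.

Let dn0 s : (0 <= dn s)%R. Proof. by rewrite mulr_ge0. Qed.

Let msq : measurable_fun [set: R * R] (sq : R * R -> measurableTypeR R).
Proof. exact: measurable_sq. Qed.

(** The area of [disc x] is proportional to [x], so [sq] pushes Lebesgue measure to a multiple of
    Lebesgue measure on the half-line. The rays []-oo, x[] are stable under intersection and
    generate, and the rays []-oo, n[] of finite measure exhaust the line. *)
Let radial_measure (A : set R) : measurable A ->
  image_measure mu2 msq A = density mu mdn dn0 A.
Proof.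
move=> mA.
pose m1 : {measure set (measurableTypeR R) -> \bar R} := image_measure mu2 msq.
pose m2 : {measure set (measurableTypeR R) -> \bar R} := density mu mdn dn0.
apply: (@measure_unique _ R (measurableTypeR R) (@RGenInftyO.G R)
  (fun n => `]-oo, n%:R[%classic) _ _ _ _ m1 m2 _ _ A mA).

- exact: RGenInftyO.measurableE.
- move=> _ _ [x ->] [y ->]; exists (Order.min x y).
  by apply/seteqP; split => z /=; rewrite !in_itv/= lt_min; [move=> [-> ->]|move=> /andP].
- by move=> n; exists n%:R.
- apply/seteqP; split => // x _; exists (Num.truncn (x : R)).+1 => //=.
  by rewrite in_itv/= truncnS_gt.
- move=> _ [x ->].
  have -> : m1 `]-oo, x[%classic = mu2 (disc x).
    by rewrite /m1/= /pushforward; congr (mu2 _); apply/seteqP; split => w /=; rewrite in_itv.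
  rewrite /m2/= /density.
  under eq_integral do rewrite EFinM.
  rewrite ge0_integralZl//; first last.
  - by apply/measurable_EFinP/measurable_indic; exact: measurable_itv.
  rewrite integral_indic; [|exact: measurable_itv|exact: measurable_itv].
  have [x0|x0] := leP x 0%R.
    rewrite disc_le0// (_ : _ `&` _ = set0) ?measure0 ?mule0//.
    apply/seteqP; split => // z /=; rewrite !in_itv/= andbT => -[z0 zx].
    by move: (le_lt_trans z0 zx); rewrite ltNge x0.
  rewrite disc_scale// A1E muleC; congr (_ * _).
  have Lx : @lebesgue_measure R `[0%R, x[%classic = x%:E.
    by rewrite lebesgue_measure_itv/= lte_fin x0 sube0.
  rewrite (_ : _ `&` _ = `[0%R, x[%classic).
    exact/esym/Lx.
  apply/seteqP; split => z /=; rewrite !in_itv/= ?andbT; first by move=> [-> ->].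
  by move=> /andP.
- move=> n.
  have -> : m1 `]-oo, n%:R[%classic = mu2 (disc n%:R).
    by rewrite /m1/= /pushforward; congr (mu2 _); apply/seteqP; split => w /=; rewrite in_itv.
  have [n0|n0] := leP (n%:R : R) 0%R; first by rewrite disc_le0// ltry.
  by rewrite disc_scale// A1E -EFinM ltry.
Qed.

Let ge0_integral_radial_cst (F : R -> \bar R) : measurable_fun [set: R] F ->
  (forall s, 0 <= F s) ->
  \int[mu2]_w F (sq w) = A1%:E * \int[mu]_(s in `[0%R, +oo[) F s.
Proof.
move=> mF F0.
transitivity (\int[image_measure mu2 msq]_s F s).
  by rewrite ge0_integral_pushforward.
transitivity (\int[density mu mdn dn0]_s F s).
  by apply: eq_measure_integral => A mA _; exact: radial_measure.
rewrite ge0_integral_density//.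
transitivity (\int[mu]_s (A1%:E * (F s * (\1_(`[0%R, +oo[%classic) s)%:E))).
  by apply: eq_integral => s _; rewrite /dn EFinM muleCA.
have mI : measurable_fun [set: R] (fun s : R => (\1_(`[0%R, +oo[%classic) s : R)%:E).
  by apply/measurable_EFinP/measurable_indic; exact: measurable_itv.
rewrite ge0_integralZl//; first last.
- by move=> s _; rewrite mule_ge0.
- exact: emeasurable_funM.
congr (_ * _); rewrite [RHS]integral_mkcond; apply: eq_integral => s _.
by rewrite patchE indicE; case: ifPn => _; rewrite ?mule1 ?mule0.
Qed.

(* The Gaussian integral over the plane gives the area of the unit disc. *)
Let A1_pi : A1 = pi.
Proof.
apply: EFin_inj.
have mg : measurable_fun [set: R] (fun x : R => (gauss_fun x)%:E).
  by apply/measurable_EFinP; exact: measurable_gauss_fun.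
have mexp : measurable_fun [set: R] (fun s : R => (expR (- s))%:E).
  apply/measurable_EFinP; apply: measurableT_comp => //; exact: oppr_measurable.
have E1 : \int[mu]_(s in `[0%R, +oo[) (expR (- s))%:E = 1.
  rewrite -(integral_exponential_pdf (R := R) ltr01) [LHS]integral_mkcond.
  apply: eq_integral => s _; rewrite /exponential_pdf !patchE.
  by case: ifPn => // _; rewrite mul1r mulN1r.
rewrite -[LHS]mule1 -E1 -ge0_integral_radial_cst//.
have mprod : measurable_fun [set: R * R] (fun w : R * R => (expR (- sq w))%:E).
  by apply: (measurableT_comp mexp); exact: measurable_sq.
rewrite ge0_integral_prod//.
transitivity (\int[mu]_x ((gauss_fun x)%:E * (Num.sqrt pi)%:E)).
  apply: eq_integral => x _; rewrite -integralT_gauss -ge0_integralZl//; first last.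
  - by rewrite lee_fin gauss_fun_ge0.
  - by move=> y _; rewrite lee_fin gauss_fun_ge0.
  by apply: eq_integral => y _; rewrite -EFinM /gauss_fun -expRD /sq/= opprD.
rewrite ge0_integralZr//; last by move=> y _; rewrite lee_fin gauss_fun_ge0.
by rewrite integralT_gauss -EFinM -expr2 sqr_sqrtr// pi_ge0.
Qed.

Lemma ge0_integral_radial (F : R -> \bar R) : measurable_fun [set: R] F ->
  (forall s, 0 <= F s) ->
  \int[mu2]_w F (sq w) = pi%:E * \int[mu]_(s in `[0%R, +oo[) F s.
Proof. by move=> mF F0; rewrite ge0_integral_radial_cst// A1_pi. Qed.

End radial.

(** * Invariance of the Fubini-Study measure *)

Section cmeasurable.
Context d (T : measurableType d) (R : realType).
Implicit Types f g : T -> R[i].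

Definition cmeasurable f := measurable_fun [set: T] (fun x => pt (f x)).

Lemma cmeasurableP f : cmeasurable f <->
  measurable_fun [set: T] (fun x => complex.Re (f x)) /\
  measurable_fun [set: T] (fun x => complex.Im (f x)).
Proof.
split=> [/measurable_fun_pairP[mf1 mf2]|[mf1 mf2]]; first by split.
exact: measurable_fun_pair.
Qed.

Lemma cmeasurable_cst (c : R[i]) : cmeasurable (fun=> c).
Proof. exact: measurable_cst. Qed.

Lemma cmeasurable_real (r : T -> R) : measurable_fun [set: T] r -> cmeasurable (fun x => (r x)%:C).
Proof. by move=> mr; apply: measurable_fun_pair => //; exact: measurable_cst. Qed.

Lemma cmeasurable_cplx (h : T -> R * R) : measurable_fun [set: T] h -> cmeasurable (fun x => cplx (h x)).
Proof. by move=> mh; rewrite /cmeasurable; under eq_fun do rewrite cplxK. Qed.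

Lemma cmeasurableD f g : cmeasurable f -> cmeasurable g -> cmeasurable (fun x => f x + g x).
Proof.
move=> /cmeasurableP[f1 f2] /cmeasurableP[g1 g2]; apply/cmeasurableP; split.
  by rewrite (_ : (fun x => _) = (fun x => complex.Re (f x) + complex.Re (g x)));
    [exact: measurable_funD|apply/funext => x; case: (f x) (g x) => ? ? []].
by rewrite (_ : (fun x => _) = (fun x => complex.Im (f x) + complex.Im (g x)));
  [exact: measurable_funD|apply/funext => x; case: (f x) (g x) => ? ? []].
Qed.

Lemma cmeasurableM f g : cmeasurable f -> cmeasurable g -> cmeasurable (fun x => f x * g x).
Proof.
move=> /cmeasurableP[f1 f2] /cmeasurableP[g1 g2]; apply/cmeasurableP; split.
  rewrite (_ : (fun x => _) = (fun x => complex.Re (f x) * complex.Re (g x) - complex.Im (f x) * complex.Im (g x))).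
    by apply: measurable_funB; exact: measurable_funM.
  by apply/funext => x; case: (f x) (g x) => ? ? [].
rewrite (_ : (fun x => _) = (fun x => complex.Re (f x) * complex.Im (g x) + complex.Im (f x) * complex.Re (g x))).
  by apply: measurable_funD; exact: measurable_funM.
by apply/funext => x; case: (f x) (g x) => ? ? [].
Qed.

Lemma cmeasurableX f n : cmeasurable f -> cmeasurable (fun x => f x ^+ n).
Proof.
move=> mf; elim: n => [|n ih]; first exact: cmeasurable_cst.
by rewrite /cmeasurable; under eq_fun do rewrite exprS; exact: cmeasurableM.
Qed.

Lemma cmeasurable_conj f : cmeasurable f -> cmeasurable (fun x => conjc (f x)).
Proof.
move=> /cmeasurableP[f1 f2]; apply/cmeasurableP; split.
  by rewrite (_ : (fun x => _) = (fun x => complex.Re (f x)))//; apply/funext => x; case: (f x).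
rewrite (_ : (fun x => _) = (fun x => - complex.Im (f x))); first exact: measurable_funN.
by apply/funext => x; case: (f x).
Qed.

Lemma measurable_sqmod f : cmeasurable f -> measurable_fun [set: T] (fun x => sqmod (f x)).
Proof. by move=> /cmeasurableP[f1 f2]; apply: measurable_funD; exact: measurable_funX. Qed.

Lemma measurable_ge0_funV (h : T -> R) : measurable_fun [set: T] h ->
  (forall x, 0 <= h x) -> measurable_fun [set: T] (fun x => (h x)^-1).
Proof.
(* On nonnegative reals inversion, including the convention that 0 has inverse 0, is the power with
   exponent -1. *)
move=> mh h0; under eq_fun do rewrite -powR_inv1//.
rewrite (_ : (fun x => _) = (@powR R ^~ (-1)) \o h)//.
by apply: measurableT_comp => //; exact: measurable_powR.
Qed.

Lemma cmeasurableV f : cmeasurable f -> cmeasurable (fun x => (f x)^-1).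
Proof.
move=> mf; have /cmeasurableP[f1 f2] := mf.
have mi : measurable_fun [set: T] (fun x => (sqmod (f x))^-1).
  by apply: measurable_ge0_funV; [exact: measurable_sqmod|move=> x; exact: sqmod_ge0].
apply/cmeasurableP; split.
  rewrite (_ : (fun x => _) = (fun x => complex.Re (f x) * (sqmod (f x))^-1)).
    exact: measurable_funM.
  by apply/funext => x; case: (f x).
rewrite (_ : (fun x => _) = (fun x => - (complex.Im (f x) * (sqmod (f x))^-1))).
  by apply: measurable_funN; exact: measurable_funM.
by apply/funext => x; case: (f x).
Qed.

End cmeasurable.

(** A name for the product measure that can carry a sigma-finite structure, on which Tonelli for
    pairs of points of the plane relies. *)
Definition lebesgue_measure2 (R : realType) :
    set (measurableTypeR R * measurableTypeR R) -> \bar R :=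
  (@lebesgue_measure R \x @lebesgue_measure R)%E.

HB.instance Definition _ (R : realType) := Measure.on (@lebesgue_measure2 R).

Lemma sigma_finite_lebesgue_measure2 (R : realType) :
  sigma_finite [set: measurableTypeR R * measurableTypeR R] (@lebesgue_measure2 R).
Proof.
exists (fun n => disc n%:R).
  apply/seteqP; split => // w _; exists (Num.truncn (sq w)).+1 => //.
  by rewrite /disc/= truncnS_gt.
move=> n; split; first exact: measurable_disc.
have [n0|n0] := leP (n%:R : R) 0; first by rewrite /lebesgue_measure2 disc_le0.
rewrite /lebesgue_measure2 disc_scale// lte_mul_pinfty ?lee_fin ?ltW//.
exact: disc1_lty.
Qed.

HB.instance Definition _ (R : realType) := @Measure_isSigmaFinite.Build _ _ _
  (@lebesgue_measure2 R) (@sigma_finite_lebesgue_measure2 R).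

Lemma mem_set_bool (T : Type) (p : T -> bool) (x : T) : (x \in [set x | p x]) = p x.
Proof. by apply/idP/idP; rewrite inE. Qed.

Lemma mule_congr2 (R : realType) (p q r : R) (I J : \bar R) : p * q = r -> I = J ->
  (p%:E * (q%:E * I) = r%:E * J)%E.
Proof. by move=> <- <-; rewrite muleA EFinM. Qed.

(** The final cancellation in [ge0_integral_mobius]. The integrals may be infinite, so only the
    finite non-zero factors are divided out. *)
Lemma mule_cancel4 (R : realType) (p q r : R) (x y h g gm : \bar R) :
  (h = p%:E * x -> g = q%:E * y -> g = r%:E * gm -> h = gm ->
  q = (r * p)%R -> p != 0%R -> r != 0%R -> x = y)%E.
Proof.
move=> hx gy ggm hgm qE p0 r0; move: gy; rewrite ggm -hgm hx qE muleA -EFinM.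
move=> /(congr1 (fun t => (r * p)^-1%:E * t)%E).
by rewrite !muleA -!EFinM mulVf ?mulf_neq0// !mul1e.
Qed.

(** * The Hopf map and unitary invariance *)

Section hopf.
Context (R : realType).
Local Notation mu := (@lebesgue_measure R).
Local Notation mu2 := (@lebesgue_measure R \x @lebesgue_measure R)%E.
Local Notation P := (R * R)%type.
Local Open Scope ereal_scope.

Lemma ge0_integral2_swap (F : P * P -> \bar R) : measurable_fun [set: P * P] F ->
  (forall w, 0 <= F w) ->
  \int[mu2]_x \int[mu2]_y F (x, y) = \int[mu2]_y \int[mu2]_x F (x, y).
Proof.
by move=> mF F0; exact: (fubini_tonelli (m1 := @lebesgue_measure2 R) (m2 := @lebesgue_measure2 R) F).
Qed.

Lemma measurable_ge0_integral2_1 (F : P * P -> \bar R) : measurable_fun [set: P * P] F ->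
  (forall w, 0 <= F w) -> measurable_fun [set: P] (fun x => \int[mu2]_y F (x, y)).
Proof.
by move=> mF F0; exact: (measurable_fun_fubini_tonelli_F (m2 := @lebesgue_measure2 R)).
Qed.

Let m1 : measurable_fun [set: P * P] (fst : P * P -> P).
Proof. exact: measurable_fst. Qed.
Let m2 : measurable_fun [set: P * P] (snd : P * P -> P).
Proof. exact: measurable_snd. Qed.

Let c1 : cmeasurable (fun w : P * P => cplx w.1).
Proof. exact: cmeasurable_cplx. Qed.
Let c2 : cmeasurable (fun w : P * P => cplx w.2).
Proof. exact: cmeasurable_cplx. Qed.

Let shear_v (e l : R[i]) (F : P * P -> \bar R) : e != 0%R ->
  measurable_fun [set: P * P] F -> (forall w, 0 <= F w) ->
  \int[mu2]_u \int[mu2]_v F (u, v) =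
  (sqmod e)%:E * \int[mu2]_u \int[mu2]_v F (u, pt (e * cplx v + l * cplx u)%R).
Proof.
move=> e0 mF F0; rewrite -ge0_integralZl//; first last.
- by rewrite lee_fin sqmod_ge0.
- by move=> u _; apply: integral_ge0 => v _; exact: F0.
- apply: (measurable_ge0_integral2_1 (F := fun w => F (w.1, pt (e * cplx w.2 + l * cplx w.1)%R))) => //.
  apply: measurableT_comp => //; apply: measurable_fun_pair => //.
  by apply: cmeasurableD; apply: cmeasurableM => //; exact: cmeasurable_cst.
apply: eq_integral => u _; apply: ge0_integral_cmul => //.
exact: measurableT_comp.
Qed.

Let shear_u (e l : R[i]) (F : P * P -> \bar R) : e != 0%R ->
  measurable_fun [set: P * P] F -> (forall w, 0 <= F w) ->
  \int[mu2]_v \int[mu2]_u F (u, v) =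
  (sqmod e)%:E * \int[mu2]_v \int[mu2]_u F (pt (e * cplx u + l * cplx v)%R, v).
Proof.
move=> e0 mF F0.
apply: (shear_v (F := fun w => F (w.2, w.1)) l e0) => //.
by apply: measurableT_comp => //; exact: measurable_fun_pair.
Qed.

(** For [a != 0] the map factors as [u' = a u - conjc b v] at fixed [v], followed by
    [v' = (k / a) v + (b / a) u'] at fixed [u'], because [k - sqmod b = sqmod a]. The Jacobians are
    [sqmod a] and [sqmod (k / a)], with product [k ^+ 2]. *)
Lemma ge0_integral_unitary (a b : R[i]) (k : R) (F : P * P -> \bar R) :
  k = (sqmod a + sqmod b)%R -> (0 < k)%R ->
  measurable_fun [set: P * P] F -> (forall w, 0 <= F w) ->
  \int[mu2]_u \int[mu2]_v F (u, v) = (k ^+ 2)%:E * \int[mu2]_u \int[mu2]_v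
    F (pt (a * cplx u - conjc b * cplx v)%R, pt (b * cplx u + conjc a * cplx v)%R).
Proof.
move=> kE k0 mF F0.
have kC0 : k%:C != 0%R by rewrite eq_complex/= eqxx andbT gt_eqF.
(* For [a = 0] the map exchanges the two coordinates up to the factors [b] and [- conjc b]. *)
have [a0|a0] := eqVneq a 0%R.
  have b0 : b != 0%R.
    by apply/eqP => b0; move: k0; rewrite kE a0 b0 !sqmod0 addr0 ltxx.
  have cb0 : (- conjc b != 0)%R by rewrite oppr_eq0 conjc_eq0.
  pose G (w : P * P) := F (w.1, pt (b * cplx w.2 + 0 * cplx w.1)%R).
  have mG : measurable_fun [set: P * P] G.
    apply: measurableT_comp => //; apply: measurable_fun_pair => //.
    by apply: cmeasurableD; apply: cmeasurableM => //; exact: cmeasurable_cst.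
  have G0 w : 0 <= G w by exact: F0.
  have E1 : \int[mu2]_u \int[mu2]_v F (u, v) = _ := shear_v 0%R b0 mF F0.
  have E2 : \int[mu2]_u \int[mu2]_v G (u, v) = _ := ge0_integral2_swap mG G0.
  have E3 : \int[mu2]_v \int[mu2]_u G (u, v) = _ := shear_u 0%R cb0 mG G0.
  apply: (etrans E1); rewrite [X in _ * X](etrans E2 E3).
  apply: mule_congr2.
    by rewrite kE a0 sqmod0 add0r sqmodN sqmodJ expr2.
  apply: eq_integral => u _; apply: eq_integral => v _; congr (F (pt _, pt _)).
    by rewrite a0 !mul0r addr0 add0r mulNr.
  by rewrite a0 conjc0 !mul0r.
have e0 : (k%:C / a != 0)%R by rewrite mulf_neq0// invr_eq0.
pose G (w : P * P) := F (w.1, pt (k%:C / a * cplx w.2 + b / a * cplx w.1)%R).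
have mG : measurable_fun [set: P * P] G.
  apply: measurableT_comp => //; apply: measurable_fun_pair => //.
  by apply: cmeasurableD; apply: cmeasurableM => //; exact: cmeasurable_cst.
have G0 w : 0 <= G w by exact: F0.
pose H (w : P * P) := G (pt (a * cplx w.1 + - conjc b * cplx w.2)%R, w.2).
have mH : measurable_fun [set: P * P] H.
  apply: measurableT_comp => //; apply: measurable_fun_pair => //.
  by apply: cmeasurableD; apply: cmeasurableM => //; exact: cmeasurable_cst.
have H0 w : 0 <= H w by exact: F0.
have E1 : \int[mu2]_u \int[mu2]_v F (u, v) = _ := shear_v (b / a)%R e0 mF F0.
have E2 : \int[mu2]_u \int[mu2]_v G (u, v) = _ := ge0_integral2_swap mG G0.
have E3 : \int[mu2]_v \int[mu2]_u G (u, v) = _ := shear_u (- conjc b)%R a0 mG G0.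
have E4 : _ = \int[mu2]_v \int[mu2]_u H (u, v) := ge0_integral2_swap mH H0.
apply: (etrans E1); rewrite [X in _ * X](etrans E2 E3).
rewrite -[X in _ * (_ * X)]E4; apply: mule_congr2.
  exact: sqmod_divK.
apply: eq_integral => u _; apply: eq_integral => v _; rewrite /H/G/=; congr (F (pt _, pt _)).
  by rewrite mulNr.
have -> : k%:C = (a * conjc a + b * conjc b)%R by rewrite !mul_conjc kE rmorphD.
by rewrite ptK; field.
Qed.

(** The integral along a fibre of the Hopf map: [A] will be [1 + sq z], and the factor [sq u] is the
    Jacobian of [v = u z]. In the variable [s = sq u] it is [pi] times the integral of [s] over
    [[0, c / A]]. *)
Let hopf_cst (c A : R) : (0 < c)%R -> (0 < A)%R ->
  \int[mu2]_u ((sq u)%:E * (\1_[set s | (s * A < c)%R] (sq u))%:E) =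
  (pi * c ^+ 2 / 2 * (A^-1) ^+ 2)%:E.
Proof.
move=> c0 A0.
(* The absolute value makes the integrand nonnegative on the whole line, as the radial formula
   asks. *)
pose f (s : R) := (`|s| * \1_[set s | (s * A < c)%R] s)%:E.
have mI : measurable_fun [set: R] (\1_[set s : R | (s * A < c)%R] : R -> R).
  apply: measurable_indic; apply: measurable_sublevel; exact: measurable_funM.
have mf : measurable_fun [set: R] f.
  by apply/measurable_EFinP; apply: measurable_funM => //; exact: normr_measurable.
have f0 s : 0 <= f s by rewrite lee_fin mulr_ge0.
transitivity (\int[mu2]_u f (sq u)).
  by apply: eq_integral => u _; rewrite /f EFinM ger0_norm// sq_ge0.
rewrite ge0_integral_radial//.
have cA : (0 < c / A)%R by rewrite divr_gt0.
have -> : \int[mu]_(s in `[0%R, +oo[) f s = \int[mu]_(s in `[0%R, (c / A)%R]) s%:E.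
  rewrite -[RHS]integral_itv_bndo_bndc//.
  rewrite [LHS]integral_mkcond [RHS]integral_mkcond; apply: eq_integral => s _.
  rewrite !patchE !mem_setE !in_itv/= andbT /f indicE mem_set_bool.
  have [s0|s0]//= := leP 0%R s; rewrite ger0_norm// -ltr_pdivlMr//.
  by case: ifP; rewrite ?mulr1 ?mulr0.
rewrite (@continuous_FTC2 _ _ (fun x => x ^+ 2 * 2^-1)%R)//.
- by rewrite -EFinB -EFinM; congr EFin; rewrite expr0n/=; field; rewrite gt_eqF.
- by apply: continuous_subspaceT => x; exact: cvg_id.
- split.
  + by move=> x _; apply: derivableM => //; exact: exprn_derivable.
  + apply: cvg_at_right_filter; apply: cvgM; last exact: cvg_cst.
    exact: exprn_continuous.
  + apply: cvg_at_left_filter; apply: cvgM; last exact: cvg_cst.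
    exact: exprn_continuous.
- move=> x _; rewrite derive1Mr//.
  by rewrite derive1E exp_derive// /GRing.scale/= mulr1 expr1 mulrAC divff// mul1r.
Qed.

Definition homball (c : R) : set (P * P) := [set w | (sq w.1 + sq w.2 < c)%R].

Lemma measurable_homball c : measurable (homball c).
Proof.
apply: measurable_sublevel; apply: measurable_funD; apply: measurableT_comp => //; exact: measurable_sq.
Qed.

(* Integrating over a ball of C^2 rather than over the sphere makes the Hopf
   fibration accessible to Fubini and linear changes of variables. *)
Lemma ge0_integral_hopf (c : R) (F : P -> \bar R) : (0 < c)%R ->
  measurable_fun [set: P] F -> (forall w, 0 <= F w) ->
  \int[mu2]_u \int[mu2]_v (F (pt (cplx v / cplx u)%R) * (\1_(homball c) (u, v))%:E) =
  (pi * c ^+ 2 / 2)%:E * \int[mu2]_z (F z * ((1 + sq z)^-1 ^+ 2)%:E).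
Proof.
move=> c0 mF F0.
pose G (w : P * P) := F (pt (cplx w.2 / cplx w.1)%R) * (\1_(homball c) w)%:E.
have mI : measurable_fun [set: P * P] (fun w : P * P => (\1_(homball c) w)%:E : \bar R).
  by apply/measurable_EFinP/measurable_indic; exact: measurable_homball.
have mG : measurable_fun [set: P * P] G.
  apply: emeasurable_funM => //; apply: measurableT_comp => //.
  by apply: cmeasurableM => //; exact: cmeasurableV.
have G0 w : 0 <= G w by rewrite mule_ge0.
pose I (w : P * P) : R := \1_[set w : P * P | (sq w.1 * (1 + sq w.2) < c)%R] w.
have msq1 : measurable_fun [set: P * P] (fun w => sq w.1).
  by apply: measurableT_comp => //; exact: measurable_sq.
have msq2 : measurable_fun [set: P * P] (fun w => sq w.2).
  by apply: measurableT_comp => //; exact: measurable_sq.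
have mI2 : measurable_fun [set: P * P] I.
  apply: measurable_indic; apply: measurable_sublevel; apply: measurable_funM => //.
  exact: measurable_funD.
pose H (w : P * P) := F w.2 * ((sq w.1)%:E * (I w)%:E).
have mH : measurable_fun [set: P * P] H.
  apply: emeasurable_funM; first exact: measurableT_comp.
  by apply: emeasurable_funM; exact/measurable_EFinP.
have H0 w : 0 <= H w by rewrite !mule_ge0 ?lee_fin ?sq_ge0.
(* For [u] off the null set [{0}], substitute [v = u z]: the Jacobian is [sq u], and the ball
   becomes [sq u * (1 + sq z) < c]. *)
transitivity (\int[mu2]_u \int[mu2]_v H (u, v)).
  apply: (eq_integral_outside (mu := @lebesgue_measure2 R) (N := [set (0, 0)%R])).
  - exact: measurable_point.
  - exact: lebesgue_measure2_point.
  - exact: (measurable_ge0_integral2_1 mG G0).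
  - exact: (measurable_ge0_integral2_1 mH H0).
  move=> u u0.
  have u0' : cplx u != 0%R.
    by apply: contra_notN u0; rewrite -sqmod_eq0 -sqE sq_eq0 => /eqP.
  rewrite (ge0_integral_cmul 0%R u0' (F := fun v => G (u, v))); first last.
  - by move=> v; exact: G0.
  - exact: measurableT_comp.
  rewrite -ge0_integralZl//; first last.
  - by rewrite lee_fin sqmod_ge0.
  - apply: (measurableT_comp mG); apply: measurable_fun_pair => //.
    apply: cmeasurableD; last exact: cmeasurable_cst.
    by apply: cmeasurableM; [exact: cmeasurable_cst|exact: cmeasurable_cplx].
  apply: eq_integral => z _; rewrite /G/= addr0 !ptK mulrAC divff// mul1r cplxK.
  rewrite muleCA; congr (_ * (_ * _)).
  rewrite /I !indicE; congr (_%:R%:E); rewrite !mem_set_bool/= sq_pt sqmodM -!sqE.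
  by rewrite [in RHS]mulrDr mulr1.
rewrite (ge0_integral2_swap mH H0) -ge0_integralZl//; first last.
- by rewrite lee_fin divr_ge0// mulr_ge0 ?pi_ge0// sqr_ge0.
- by move=> z _; rewrite mule_ge0// lee_fin sqr_ge0.
- apply: emeasurable_funM => //; apply/measurable_EFinP; apply: measurable_funX.
  apply: measurable_ge0_funV; last by move=> z; rewrite addr_ge0 ?sq_ge0.
  by apply: measurable_funD => //; exact: measurable_sq.
apply: eq_integral => z _; rewrite /H/= ge0_integralZl//; first last.
- by move=> u _; rewrite mule_ge0 ?lee_fin ?sq_ge0.
- apply: emeasurable_funM; first by apply/measurable_EFinP; exact: measurable_sq.
  apply/measurable_EFinP; apply: (measurableT_comp mI2).
  by apply: measurable_fun_pair.
rewrite muleCA; congr (_ * _); rewrite -EFinM -hopf_cst//; last by rewrite ltr_pwDl ?sq_ge0.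
Qed.

(* The map of CP^1 induced by the multiple [[a, - conjc b], [b, conjc a]] of a
   unitary matrix; it sends 0 to b / a. *)
Definition mobius (a b z : R[i]) : R[i] := ((b + conjc a * z) / (a - conjc b * z))%R.

Lemma cmeasurable_mobius (a b : R[i]) : cmeasurable (fun w : P => mobius a b (cplx w)).
Proof.
have mc : cmeasurable (fun w : P => cplx w) by exact: cmeasurable_cplx.
apply: cmeasurableM; last apply: cmeasurableV.
  by apply: cmeasurableD; [exact: cmeasurable_cst|apply: cmeasurableM => //; exact: cmeasurable_cst].
rewrite (_ : (fun w => _) = (fun w : P => a + (- conjc b) * cplx w)%R).
  by apply: cmeasurableD; [exact: cmeasurable_cst|apply: cmeasurableM => //; exact: cmeasurable_cst].
by apply/funext => w; rewrite mulNr.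
Qed.

Let mobius_div (a b u v : R[i]) : u != 0%R ->
  mobius a b (v / u)%R = ((b * u + conjc a * v) / (a * u - conjc b * v))%R.
Proof.
move=> u0; rewrite /mobius.
have -> : (b + conjc a * (v / u) = (b * u + conjc a * v) / u)%R by field.
have -> : (a - conjc b * (v / u) = (a * u - conjc b * v) / u)%R by field.
by rewrite invfM invrK mulrA -[(_ / u / _)%R]mulrA (mulrC u^-1%R) mulrA divfK.
Qed.

Let sqmod_unitary (a b u v : R[i]) :
  (sqmod (a * u - conjc b * v) + sqmod (b * u + conjc a * v) =
   (sqmod a + sqmod b) * (sqmod u + sqmod v))%R.
Proof. by case: a b u v => a1 a2 [b1 b2] [u1 u2] [v1 v2]; rewrite /sqmod/=; ring. Qed.

(** The linear map with matrix [[[a, - conjc b], [b, conjc a]]] takes [homball 1] onto [homball k],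
    has Jacobian [k ^+ 2], and induces [mobius a b] on the quotients [v / u]. Comparing the Hopf
    formula on the two balls, whose constants also differ by [k ^+ 2], gives the invariance. *)
Lemma ge0_integral_mobius (a b : R[i]) (F : P -> \bar R) :
  (0 < sqmod a + sqmod b)%R ->
  measurable_fun [set: P] F -> (forall w, 0 <= F w) ->
  \int[mu2]_z (F (pt (mobius a b (cplx z))) * ((1 + sq z)^-1 ^+ 2)%:E) =
  \int[mu2]_z (F z * ((1 + sq z)^-1 ^+ 2)%:E).
Proof.
set k := (sqmod a + sqmod b)%R => k0 mF F0.
have p0 : (pi * 1 ^+ 2 / 2 : R)%R != 0%R.
  by rewrite expr1n mulr1 gt_eqF// divr_gt0// pi_gt0.
have k20 : (k ^+ 2 : R)%R != 0%R by rewrite expf_neq0// gt_eqF.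
have kp : (pi * k ^+ 2 / 2 = k ^+ 2 * (pi * 1 ^+ 2 / 2))%R.
  by rewrite expr1n mulr1; field.
have mI c : measurable_fun [set: P * P] (fun w : P * P => (\1_(homball c) w)%:E : \bar R).
  by apply/measurable_EFinP/measurable_indic; exact: measurable_homball.
pose Fm z := F (pt (mobius a b (cplx z))).
have mFm : measurable_fun [set: P] Fm.
  by apply: measurableT_comp => //; exact: cmeasurable_mobius.
have Fm0 z : 0 <= Fm z by exact: F0.
pose G (w : P * P) := F (pt (cplx w.2 / cplx w.1)%R) * (\1_(homball k) w)%:E.
have mG : measurable_fun [set: P * P] G.
  apply: emeasurable_funM => //; apply: measurableT_comp => //.
  by apply: cmeasurableM => //; exact: cmeasurableV.
have G0 w : 0 <= G w by rewrite mule_ge0.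
pose H (w : P * P) := Fm (pt (cplx w.2 / cplx w.1)%R) * (\1_(homball 1) w)%:E.
have mH : measurable_fun [set: P * P] H.
  apply: emeasurable_funM => //; apply: measurableT_comp => //.
  by apply: cmeasurableM => //; exact: cmeasurableV.
have H0 w : 0 <= H w by rewrite mule_ge0.
pose GM (w : P * P) := G (pt (a * cplx w.1 - conjc b * cplx w.2)%R,
                          pt (b * cplx w.1 + conjc a * cplx w.2)%R).
have mGM : measurable_fun [set: P * P] GM.
  apply: measurableT_comp => //; apply: measurable_fun_pair.
    rewrite (_ : (fun w => _) = (fun w : P * P => pt (a * cplx w.1 + (- conjc b) * cplx w.2)%R)).
      by apply: cmeasurableD; apply: cmeasurableM => //; exact: cmeasurable_cst.
    by apply/funext => w; rewrite mulNr.
  by apply: cmeasurableD; apply: cmeasurableM => //; exact: cmeasurable_cst.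
have GM0 w : 0 <= GM w by exact: G0.
have E1 : \int[mu2]_u \int[mu2]_v H (u, v) = _ := ge0_integral_hopf ltr01 mFm Fm0.
have E2 : \int[mu2]_u \int[mu2]_v G (u, v) = _ := ge0_integral_hopf k0 mF F0.
have E3 : \int[mu2]_u \int[mu2]_v G (u, v) =
    (k ^+ 2)%:E * \int[mu2]_u \int[mu2]_v GM (u, v) :=
  ge0_integral_unitary (erefl k) k0 mG G0.
have E4 : \int[mu2]_u \int[mu2]_v H (u, v) = \int[mu2]_u \int[mu2]_v GM (u, v).
  apply: (eq_integral_outside (mu := @lebesgue_measure2 R) (N := [set (0, 0)%R])).
  - exact: measurable_point.
  - exact: lebesgue_measure2_point.
  - exact: (measurable_ge0_integral2_1 mH H0).
  - exact: (measurable_ge0_integral2_1 mGM GM0).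
  move=> u u0; have u0' : cplx u != 0%R.
    by apply: contra_notN u0; rewrite -sqmod_eq0 -sqE sq_eq0 => /eqP.
  apply: eq_integral => v _; rewrite /H /GM /G /Fm /= !ptK mobius_div//; congr (_ * _).
  rewrite !indicE !mem_set_bool/= !sq_pt sqmod_unitary -!sqE -/k.
  by rewrite gtr_pMr.
exact: (mule_cancel4 E1 E2 E3 E4 kp p0 k20).
Qed.

End hopf.

(** * The Fubini-Study measure and the distribution of the height *)

Section fs_measure.
Context (R : realType).
Local Notation mu := (@lebesgue_measure R).
Local Notation mu2 := (@lebesgue_measure R \x @lebesgue_measure R)%E.
Local Notation P := (measurableTypeR R * measurableTypeR R)%type.

Definition fs_weight (w : P) : R := (pi * (1 + sq w) ^+ 2)^-1.

Lemma fs_weight_ge0 w : 0 <= fs_weight w.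
Proof. by rewrite invr_ge0 mulr_ge0 ?pi_ge0// sqr_ge0. Qed.

Lemma measurable_fs_weight : measurable_fun [set: P] fs_weight.
Proof.
apply: measurable_ge0_funV; last by move=> w; rewrite mulr_ge0 ?pi_ge0// sqr_ge0.
apply: measurable_funM => //; apply: measurable_funX; apply: measurable_funD => //.
exact: measurable_sq.
Qed.

Definition fs_measure : set P -> \bar R :=
  density (@lebesgue_measure2 R) measurable_fs_weight fs_weight_ge0.

HB.instance Definition _ := Measure.on fs_measure.

Local Open Scope ereal_scope.

Lemma ge0_integral_fs_measure (F : P -> \bar R) : measurable_fun [set: P] F ->
  (forall w, 0 <= F w) ->
  \int[fs_measure]_w F w = \int[mu2]_w (F w * (fs_weight w)%:E).
Proof. by move=> mF F0; rewrite ge0_integral_density. Qed.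

Lemma fs_weight_pi w : (fs_weight w = pi^-1 * (1 + sq w)^-1 ^+ 2)%R.
Proof. by rewrite /fs_weight invfM exprVn. Qed.

Let fs_measure_pi (F : P -> \bar R) : measurable_fun [set: P] F ->
  (forall w, 0 <= F w) ->
  \int[fs_measure]_w F w = pi^-1%:E * \int[mu2]_w (F w * ((1 + sq w)^-1 ^+ 2)%:E).
Proof.
move=> mF F0; rewrite ge0_integral_fs_measure// -ge0_integralZl//; first last.
- by rewrite lee_fin invr_ge0 pi_ge0.
- by move=> w _; rewrite mule_ge0// lee_fin sqr_ge0.
- apply: emeasurable_funM => //; apply/measurable_EFinP; apply: measurable_funX.
  apply: measurable_ge0_funV; last by move=> w; rewrite addr_ge0 ?sq_ge0.
  by apply: measurable_funD => //; exact: measurable_sq.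
by apply: eq_integral => w _; rewrite fs_weight_pi EFinM muleCA.
Qed.

Lemma ge0_integral_fs_mobius (a b : R[i]) (F : P -> \bar R) :
  (0 < sqmod a + sqmod b)%R ->
  measurable_fun [set: P] F -> (forall w, 0 <= F w) ->
  \int[fs_measure]_w F (pt (mobius a b (cplx w))) = \int[fs_measure]_w F w.
Proof.
move=> ab0 mF F0; rewrite !fs_measure_pi//; first by rewrite ge0_integral_mobius.
by apply: measurableT_comp => //; exact: cmeasurable_mobius.
Qed.

(** Under stereographic projection this is the height on a round sphere of diameter 1; its uniform
    distribution is the theorem of Archimedes. *)
Definition height (w : P) : measurableTypeR R := (sq w / (1 + sq w))%R.

Lemma measurable_height : measurable_fun [set: P] height.
Proof.
apply: measurable_funM; first exact: measurable_sq.
apply: measurable_ge0_funV; last by move=> w; rewrite addr_ge0 ?sq_ge0.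
by apply: measurable_funD => //; exact: measurable_sq.
Qed.

Lemma height_ge0 w : (0 <= height w)%R.
Proof. by apply: divr_ge0; [exact: sq_ge0|apply: addr_ge0 => //; exact: sq_ge0]. Qed.

Lemma height_lt1 w : (height w < 1)%R.
Proof. by rewrite ltr_pdivrMr ?mul1r ?ltrDr// ltr_pwDl ?sq_ge0. Qed.

Let f (s : R) := (1 + s)^-1 ^+ 2 : R.

Let der (x : R) : (0 <= x)%R -> is_derive x 1%R (fun s : R => - (1 + s)^-1)%R (f x).
Proof.
move=> x0; have x1 : (1 + x != 0)%R by rewrite gt_eqF// ltr_pwDl.
apply: is_derive_eq.
by rewrite add0r scaleNr opprK /f /GRing.scale/= mulr1 exprVn.
Qed.

Let cf (x : R) : (0 <= x)%R -> {for x, continuous f}.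
Proof.
move=> x0; have x1 : (1 + x != 0)%R by rewrite gt_eqF// ltr_pwDl.
apply: (@continuous_comp _ _ _ (fun s : R => (1 + s)^-1)%R (fun y => y ^+ 2)%R); last exact: exprn_continuous.
by apply: cvgV => //; apply: cvgD; [exact: cvg_cst|exact: cvg_id].
Qed.

Let cF (x : R) : (0 <= x)%R -> {for x, continuous (fun s : R => - (1 + s)^-1)%R}.
Proof.
move=> x0; have x1 : (1 + x != 0)%R by rewrite gt_eqF// ltr_pwDl.
by apply: cvgN; apply: cvgV => //; apply: cvgD; [exact: cvg_cst|exact: cvg_id].
Qed.

Let integral_f (r : R) : (0 < r)%R ->
  \int[mu]_(s in `[0%R, r]) (f s)%:E = (r / (1 + r))%:E.
Proof.
move=> r0; rewrite (@continuous_FTC2 _ _ (fun s : R => - (1 + s)^-1)%R)//.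
- rewrite -EFinB; congr EFin; rewrite addr0 invr1; field.
  by rewrite gt_eqF// addr_gt0.
- apply: continuous_in_subspaceT => x; rewrite inE/= in_itv/= => /andP[x0 _].
  exact: cf.
- split.
  + by move=> x; rewrite in_itv/= => /andP[x0 _]; have [] := der (ltW x0).
  + by apply: cvg_at_right_filter; exact: cF.
  + by apply: cvg_at_left_filter; apply: cF; exact: ltW.
- by move=> x; rewrite in_itv/= => /andP[x0 _]; rewrite derive1E; have [_ ->] := der (ltW x0).
Qed.

Let cvg_inv1D : (1 + x : R)^-1%R @[x --> +oo%R] --> 0%R.
Proof.
apply/gtr0_cvgV0.
  by near=> x; rewrite addr_gt0//; near: x; exact: nbhs_pinfty_gt.
apply/cvgryPge => A; near=> x; rewrite -lerBlDl.
near: x; apply: nbhs_pinfty_ge; exact: num_real.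
Unshelve. all: by end_near. Qed.

Let integral_fy : \int[mu]_(s in `[0%R, +oo[) (f s)%:E = 1.
Proof.
rewrite (@ge0_continuous_FTC2y _ _ (fun s : R => - (1 + s)^-1)%R 0%R 0%R)//.
- by rewrite addr0 invr1 sub0e -EFinN opprK.
- by move=> x _; exact: sqr_ge0.
- apply/continuous_within_itvcyP; split.
    by move=> x; rewrite in_itv/= andbT => x0; apply: cf; exact: ltW.
  by apply: cvg_at_right_filter; exact: cf.
- rewrite -oppr0; apply: cvgN; exact: cvg_inv1D.
- by move=> x x0; have [] := der (ltW x0).
- by apply: cvg_at_right_filter; exact: cF.
- by move=> x; rewrite in_itv/= andbT => x0; rewrite derive1E; have [_ ->] := der (ltW x0).
Qed.

(** Equal to [f] on the half-line, with a denominator that is positive on the whole line. *)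
Let g (s : R) : R := (1 + `|s|)^-1 ^+ 2.

Let mg : measurable_fun [set: R] g.
Proof.
apply: measurable_funX; apply: measurable_ge0_funV => [|s]; last by rewrite addr_ge0.
by apply: measurable_funD => //; exact: normr_measurable.
Qed.

Lemma ge0_integral_fs_radial (F : R -> \bar R) : measurable_fun [set: R] F ->
  (forall s, 0 <= F s) ->
  \int[fs_measure]_w F (sq w) = \int[mu]_(s in `[0%R, +oo[) (F s * ((1 + s)^-1 ^+ 2)%:E).
Proof.
move=> mF F0; rewrite fs_measure_pi//; last by apply: (measurableT_comp mF); exact: measurable_sq.
pose H s := F s * (g s)%:E.
have mH : measurable_fun [set: R] H by apply: emeasurable_funM => //; exact/measurable_EFinP.
have H0 s : 0 <= H s by rewrite mule_ge0// lee_fin sqr_ge0.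
transitivity (pi^-1%:E * \int[mu2]_w H (sq w)).
  by congr (_ * _); apply: eq_integral => w _; rewrite /H /g ger0_norm// sq_ge0.
rewrite ge0_integral_radial// muleA -EFinM mulVf ?gt_eqF ?pi_gt0// mul1e.
apply: eq_integral => s; rewrite inE/= in_itv/= andbT => s0.
by rewrite /H /g ger0_norm.
Qed.

Let fs_measure_indic (S : set P) : measurable S ->
  fs_measure S = \int[fs_measure]_w (\1_S w)%:E.
Proof. by move=> mS; rewrite integral_indic// setIT. Qed.

Lemma fs_measure_setT : fs_measure [set: P] = 1.
Proof.
rewrite fs_measure_indic//.
transitivity (\int[fs_measure]_w (cst 1 (sq w))).
  by apply: eq_integral => w _; rewrite indicE in_setT.
rewrite (ge0_integral_fs_radial (F := cst 1))// -[RHS]integral_fy.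
by apply: eq_integral => s _; rewrite mul1e.
Qed.

Lemma fs_measure_sublevel (v : R) : (0 < v < 1)%R ->
  fs_measure [set w | (height w < v)%R] = v%:E.
Proof.
move=> /andP[v0 v1].
have mS : measurable [set w : P | (height w < v)%R].
  apply: measurable_sublevel; exact: measurable_height.
(* [r] is the preimage of [v] under [s |-> s / (1 + s)], so that [height w < v] means [sq w < r]. *)
rewrite fs_measure_indic//; pose r := (v / (1 - v))%R.
have r0 : (0 < r)%R by rewrite divr_gt0// subr_gt0.
have mr : measurable [set s : R | (s < r)%R] by exact: measurable_sublevel.
transitivity (\int[fs_measure]_w (\1_[set s : R | (s < r)%R] (sq w))%:E).
  apply: eq_integral => w _; rewrite !indicE !mem_set_bool /height /r; congr (_%:R%:E).
  rewrite ltr_pdivrMr ?ltr_pwDl ?sq_ge0// ltr_pdivlMr ?subr_gt0//.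
  by rewrite mulrBr mulr1 ltrBlDr mulrDr mulr1 (mulrC v).
rewrite (ge0_integral_fs_radial (F := fun s => (\1_[set s : R | (s < r)%R] s)%:E))//; last first.
  by apply/measurable_EFinP/measurable_indic.
transitivity (\int[mu]_(s in `[0%R, r]) (f s)%:E).
  rewrite -[RHS]integral_itv_bndo_bndc; last first.
    apply: (eq_measurable_fun (fun s => (g s)%:E)).
      by move=> s; rewrite inE/= in_itv/= => /andP[s0 _]; rewrite /g ger0_norm.
    by apply: measurable_funTS; exact/measurable_EFinP.
  rewrite [LHS]integral_mkcond [RHS]integral_mkcond; apply: eq_integral => s _.
  rewrite !patchE !mem_setE !in_itv/= andbT indicE mem_set_bool.
  by have [s0|s0]//= := leP 0%R s; case: ifP; rewrite ?mul1e ?mul0e.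
rewrite integral_f//; congr EFin; rewrite /r; field.
by rewrite subrK oner_eq0 subr_eq0 gt_eqF.
Qed.

Let u01 (s : R) : R := \1_(`[0%R, 1%R]%classic) s.

Let mu01 : measurable_fun [set: R] u01.
Proof. by apply: measurable_indic; exact: measurable_itv. Qed.

Let u01_ge0 s : (0 <= u01 s)%R. Proof. by []. Qed.

Let fs_height_measure (A : set R) : measurable A ->
  image_measure fs_measure measurable_height A = density mu mu01 u01_ge0 A.
Proof.
move=> mA.
pose m1 : {measure set (measurableTypeR R) -> \bar R} := image_measure fs_measure measurable_height.
pose m2 : {measure set (measurableTypeR R) -> \bar R} := density mu mu01 u01_ge0.
have m1E (x : R) : m1 `]-oo, x[%classic = fs_measure [set w | (height w < x)%R].
  by rewrite /m1/= /pushforward; congr (fs_measure _); apply/seteqP; split => w /=; rewrite in_itv.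
apply: (@measure_unique _ R (measurableTypeR R) (@RGenInftyO.G R)
  (fun n => `]-oo, n%:R[%classic) _ _ _ _ m1 m2 _ _ A mA).
- exact: RGenInftyO.measurableE.
- move=> _ _ [x ->] [y ->]; exists (Order.min x y).
  by apply/seteqP; split => z /=; rewrite !in_itv/= lt_min; [move=> [-> ->]|move=> /andP].
- by move=> n; exists n%:R.
- apply/seteqP; split => // x _; exists (Num.truncn (x : R)).+1 => //=.
  by rewrite in_itv/= truncnS_gt.
- move=> _ [x ->]; rewrite m1E /m2/= /density integral_indic; [|exact: measurable_itv|exact: measurable_itv].
  have [x0|x0] := leP x 0%R.
    rewrite (_ : [set w | _] = set0); last first.
      apply/seteqP; split => // w /=; rewrite ltNge => /negP; apply.
      exact: le_trans (height_ge0 w).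
    rewrite measure0 (_ : _ `&` _ = set0) ?measure0//.
    apply/seteqP; split => // z /=; rewrite !in_itv/= => -[/andP[z0 _] zx].
    by move: (le_lt_trans z0 zx); rewrite ltNge x0.
  have [x1|x1] := ltP x 1%R.
    have Lx : @lebesgue_measure R `[0%R, x[%classic = x%:E.
      by rewrite lebesgue_measure_itv/= lte_fin x0 sube0.
    rewrite fs_measure_sublevel ?x0// (_ : _ `&` _ = `[0%R, x[%classic).
      exact/esym/Lx.
    apply/seteqP; split => z /=; rewrite !in_itv/=; first by move=> [/andP[-> _] ->].
    by move=> /andP[z0 zx]; rewrite z0 zx/= (ltW (lt_trans zx x1)).
  rewrite (_ : [set w | _] = setT); last first.
    by apply/seteqP; split => // w _ /=; exact: lt_le_trans (height_lt1 w) x1.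
  rewrite fs_measure_setT.
  (* At [x = 1] the open ray meets [[0, 1]] in a half-open interval, beyond it in the closed one;
     both have length 1. *)
  have [<-|xn1] := eqVneq 1%R x.
    have Lx : @lebesgue_measure R `[0%R, 1%R[%classic = 1.
      by rewrite lebesgue_measure_itv/= lte_fin ltr01 sube0.
    rewrite (_ : _ `&` _ = `[0%R, 1%R[%classic); first exact/esym/Lx.
    apply/seteqP; split => z /=; rewrite !in_itv/=; first by move=> [/andP[-> _] ->].
    by move=> /andP[z0 zx]; rewrite z0 zx (ltW zx).
  have Lx : @lebesgue_measure R `[0%R, 1%R]%classic = 1.
    by rewrite lebesgue_measure_itv/= lte_fin ltr01 sube0.
  rewrite (_ : _ `&` _ = `[0%R, 1%R]%classic); first exact/esym/Lx.
  apply/seteqP; split => z /=; rewrite !in_itv/=; first by move=> [].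
  by move=> /andP[z0 zx]; rewrite z0 zx (le_lt_trans zx)// lt_neqAle xn1.
- move=> n; rewrite m1E; apply: (@le_lt_trans _ _ (fs_measure setT)).
    apply: le_measure; rewrite ?inE//.
    by apply: measurable_sublevel; exact: measurable_height.
  by rewrite fs_measure_setT ltry.
Qed.

Lemma ge0_integral_fs_height (F : R -> \bar R) : measurable_fun [set: R] F ->
  (forall s, 0 <= F s) ->
  \int[fs_measure]_w F (height w) = \int[mu]_(s in `[0%R, 1%R]) F s.
Proof.
move=> mF F0.
transitivity (\int[image_measure fs_measure measurable_height]_s F s).
  apply/esym; rewrite ge0_integral_pushforward//; exact: measurable_height.
transitivity (\int[density mu mu01 u01_ge0]_s F s).
  by apply: eq_measure_integral => A mA _; exact: fs_height_measure.
rewrite ge0_integral_density// [RHS]integral_mkcond.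
apply: eq_integral => s _; rewrite patchE /u01 indicE.
by case: ifPn => _; rewrite ?mule1 ?mule0.
Qed.

End fs_measure.

(** * Fubini-Study integrals of bounded functions *)

Section fs_int.
Context (R : realType).
Local Notation mu := (@lebesgue_measure R).
Local Notation mu2 := (@lebesgue_measure R \x @lebesgue_measure R)%E.
Local Notation P := (measurableTypeR R * measurableTypeR R)%type.
Local Notation fsm := (@fs_measure R).

Lemma integral_fs_measure (f : P -> R) : measurable_fun [set: P] f ->
  (\int[fsm]_w (f w)%:E = \int[mu2]_w (f w * fs_weight w)%:E)%E.
Proof.
move=> mf; have mEf : measurable_fun [set: P] (EFin \o f) by exact/measurable_EFinP.
rewrite [LHS]integralE [RHS]integralE.
rewrite !ge0_integral_fs_measure//; [|exact: measurable_funeneg|exact: measurable_funepos].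
congr (_ - _)%E; apply: eq_integral => w _.
  rewrite !funeposE/= -!EFin_max -EFinM; congr EFin.
  by rewrite maxr_pMl ?fs_weight_ge0// mul0r.
rewrite !funenegE/= -!EFin_max -EFinM; congr EFin.
by rewrite maxr_pMl ?fs_weight_ge0// mul0r mulNr.
Qed.

Lemma fs_intE (f : R[i] -> R) : measurable_fun [set: P] (fun w => f (cplx w)) ->
  fs_int f = \int[fsm]_w f (cplx w).
Proof. by move=> mf; rewrite /Rintegral integral_fs_measure. Qed.

(** Boundedness implies integrability since the total mass is 1, and unlike integrability it passes
    to products. *)
Definition bmeasurable (f : R[i] -> R) :=
  measurable_fun [set: P] (fun w => f (cplx w)) /\ exists C : R, forall z, `|f z| <= C.

Lemma bmeasurable_integrable f : bmeasurable f ->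
  fsm.-integrable [set: P] (EFin \o (fun w => f (cplx w))).
Proof.
move=> [mf [C fC]]; apply: measurable_bounded_integrable => //.
  by apply: (@le_lt_trans _ _ 1%E); [rewrite -(fs_measure_setT R)|exact: ltry].
exists C; split; first exact: num_real.
by move=> M CM w _ /=; rewrite (le_trans (fC _))// ltW.
Qed.

Lemma bmeasurable_cst c : bmeasurable (fun=> c).
Proof. by split=> //; exists `|c|. Qed.

Lemma bmeasurableN f : bmeasurable f -> bmeasurable (fun z => - f z).
Proof. by move=> [mf [C fC]]; split; [exact: measurable_funN|exists C => z; rewrite normrN]. Qed.

Lemma bmeasurableD f g : bmeasurable f -> bmeasurable g -> bmeasurable (fun z => f z + g z).
Proof.
move=> [mf [C fC]] [mg [D gD]]; split; first exact: measurable_funD.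
by exists (C + D) => z; rewrite (le_trans (ler_normD _ _))// lerD.
Qed.

Lemma bmeasurableM f g : bmeasurable f -> bmeasurable g -> bmeasurable (fun z => f z * g z).
Proof.
move=> [mf [C fC]] [mg [D gD]]; split; first exact: measurable_funM.
by exists (C * D) => z; rewrite normrM ler_pM.
Qed.

Lemma fs_intD f g : bmeasurable f -> bmeasurable g ->
  fs_int (fun z => f z + g z) = fs_int f + fs_int g.
Proof.
move=> bf bg; rewrite !fs_intE ?RintegralD//; try exact: bmeasurable_integrable.
- by case: bg.
- by case: bf.
- by case: (bmeasurableD bf bg).
Qed.

Lemma fs_intZ c f : bmeasurable f -> fs_int (fun z => c * f z) = c * fs_int f.
Proof.
move=> bf; rewrite !fs_intE ?RintegralZl//; try exact: bmeasurable_integrable.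
- by case: bf.
- by case: (bmeasurableM (bmeasurable_cst c) bf).
Qed.

Lemma fs_int_cst c : fs_int (fun=> c : R) = c.
Proof. by rewrite fs_intE// Rintegral_cst// (_ : fine _ = 1) ?mulr1//; exact: (congr1 fine (fs_measure_setT R)). Qed.

Lemma fs_int_mobius (a b : R[i]) f : 0 < sqmod a + sqmod b -> bmeasurable f ->
  fs_int (fun z => f (mobius a b z)) = fs_int f.
Proof.
move=> ab0 bf; have [mf [C fC]] := bf.
have bmo : bmeasurable (fun z => f (mobius a b z)).
  split; last by exists C.
  rewrite (_ : (fun w => _) = (fun w : P => f (cplx w)) \o (fun w => pt (mobius a b (cplx w)))).
    by apply: measurableT_comp => //; exact: cmeasurable_mobius.
  by apply/funext => w /=; rewrite ptK.
(* Adding the bound [C] to [f] makes it nonnegative, so that invariance for nonnegative functions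
   applies; as the total mass is 1, both integrals grow by exactly [C]. *)
apply: (@addIr _ C).
have intDC h : bmeasurable h -> fs_int h + C = fs_int (fun z => h z + C).
  by move=> bh; rewrite fs_intD ?fs_int_cst//; exact: bmeasurable_cst.
rewrite !intDC//.
have pos z : 0 <= f z + C by rewrite -lerBlDr sub0r; have := fC z; rewrite ler_norml => /andP[].
rewrite !fs_intE; last 2 first.
- by case: (bmeasurableD bf (bmeasurable_cst C)).
- by case: (bmeasurableD bmo (bmeasurable_cst C)).
rewrite /Rintegral; congr fine.
rewrite -(ge0_integral_fs_mobius (F := fun w => (f (cplx w) + C)%:E) ab0).
- by apply: eq_integral => w _; rewrite ptK.
- by apply/measurable_EFinP; exact: measurable_funD.
- by move=> w; rewrite lee_fin.
Qed.

Lemma fs_measure_point (w : P) : fsm [set w] = 0%E.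
Proof.
rewrite /fs_measure /density/=; apply: null_set_integral.
- exact: measurable_point.
- apply/measurable_EFinP; apply: measurable_funTS; exact: measurable_fs_weight.
- exact: lebesgue_measure2_point.
Qed.

(** Serves to discard the pole of [mobius a b], where division by zero yields a default value. *)
Lemma eq_fs_int_point (z0 : R[i]) f g :
  measurable_fun [set: P] (fun w => f (cplx w)) ->
  measurable_fun [set: P] (fun w => g (cplx w)) ->
  (forall z, z != z0 -> f z = g z) -> fs_int f = fs_int g.
Proof.
move=> mf mg fg; rewrite !fs_intE// /Rintegral; congr fine.
apply: (eq_integral_outside (mu := @fs_measure R) (N := [set pt z0])).
- exact: measurable_point.
- exact: fs_measure_point.
- exact/measurable_EFinP.
- exact/measurable_EFinP.
move=> w /= wz0; rewrite fg//; apply/eqP => wz; apply: wz0.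
by rewrite -wz cplxK.
Qed.

Lemma fs_int_height (F : R -> R) : measurable_fun [set: R] F -> (forall s, 0 <= F s) ->
  fs_int (fun z => F (height (pt z))) = \int[mu]_(s in `[0, 1]) F s.
Proof.
move=> mF F0; rewrite fs_intE; last first.
  under eq_fun do rewrite cplxK.
  by apply: (measurableT_comp mF); exact: measurable_height.
rewrite /Rintegral; congr fine; rewrite -ge0_integral_fs_height//; exact/measurable_EFinP.
Qed.

Definition cbmeasurable (f : R[i] -> R[i]) :=
  bmeasurable (fun z => complex.Re (f z)) /\ bmeasurable (fun z => complex.Im (f z)).

Lemma cbmeasurable_ext f g : f =1 g -> cbmeasurable f -> cbmeasurable g.
Proof. by move=> /funext ->. Qed.

Lemma cbmeasurable_sqmod f (C : R) : cmeasurable (fun w : P => f (cplx w)) ->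
  (forall z, sqmod (f z) <= C ^+ 2) -> 0 <= C -> cbmeasurable f.
Proof.
move=> /cmeasurableP[m1 m2] fC C0; split; split => //; exists C => z.
  rewrite -(@ler_pXn2r _ 2)// ?nnegrE// real_normK ?num_real// (le_trans _ (fC z))//.
  by rewrite lerDl sqr_ge0.
rewrite -(@ler_pXn2r _ 2)// ?nnegrE// real_normK ?num_real// (le_trans _ (fC z))//.
by rewrite lerDr sqr_ge0.
Qed.

Lemma cbmeasurable_cst (c : R[i]) : cbmeasurable (fun=> c).
Proof. by split; exact: bmeasurable_cst. Qed.

Lemma cbmeasurableD f g : cbmeasurable f -> cbmeasurable g -> cbmeasurable (fun z => f z + g z).
Proof.
move=> [f1 f2] [g1 g2]; split.
  rewrite (_ : (fun z => _) = (fun z => complex.Re (f z) + complex.Re (g z))).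
    exact: bmeasurableD.
  by apply/funext => x; case: (f x) (g x) => ? ? [].
rewrite (_ : (fun z => _) = (fun z => complex.Im (f z) + complex.Im (g z))).
  exact: bmeasurableD.
by apply/funext => x; case: (f x) (g x) => ? ? [].
Qed.

Lemma cbmeasurableM f g : cbmeasurable f -> cbmeasurable g -> cbmeasurable (fun z => f z * g z).
Proof.
move=> [f1 f2] [g1 g2]; split.
  rewrite (_ : (fun z => _) = (fun z => complex.Re (f z) * complex.Re (g z) + - (complex.Im (f z) * complex.Im (g z)))).
    by apply: bmeasurableD; [|apply: bmeasurableN]; exact: bmeasurableM.
  by apply/funext => x; case: (f x) (g x) => ? ? [].
rewrite (_ : (fun z => _) = (fun z => complex.Re (f z) * complex.Im (g z) + complex.Im (f z) * complex.Re (g z))).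
  by apply: bmeasurableD; exact: bmeasurableM.
by apply/funext => x; case: (f x) (g x) => ? ? [].
Qed.

Lemma cbmeasurable_sum (I : Type) (r : seq I) (f : I -> R[i] -> R[i]) :
  (forall i, cbmeasurable (f i)) -> cbmeasurable (fun z => \sum_(i <- r) f i z).
Proof.
move=> bf; elim: r => [|i r ih].
  by apply: (cbmeasurable_ext _ (cbmeasurable_cst 0)) => z; rewrite big_nil.
by apply: (cbmeasurable_ext _ (cbmeasurableD (bf i) ih)) => z; rewrite big_cons.
Qed.

Lemma cbmeasurable_real (r : R[i] -> R) : bmeasurable r -> cbmeasurable (fun z => (r z)%:C).
Proof. by move=> br; split => //; exact: bmeasurable_cst. Qed.

Lemma fs_cintD f g : cbmeasurable f -> cbmeasurable g ->
  fs_cint (fun z => f z + g z) = fs_cint f + fs_cint g.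
Proof.
move=> [f1 f2] [g1 g2]; rewrite /fs_cint.
rewrite (_ : (fun z => complex.Re _) = (fun z => complex.Re (f z) + complex.Re (g z))); last first.
  by apply/funext => x; case: (f x) (g x) => ? ? [].
rewrite (_ : (fun z => complex.Im _) = (fun z => complex.Im (f z) + complex.Im (g z))); last first.
  by apply/funext => x; case: (f x) (g x) => ? ? [].
by rewrite !fs_intD.
Qed.

Lemma fs_cintZ c f : cbmeasurable f -> fs_cint (fun z => c * f z) = c * fs_cint f.
Proof.
move=> [f1 f2]; rewrite /fs_cint; case: c => a b.
rewrite (_ : (fun z => complex.Re _) = (fun z => a * complex.Re (f z) + (- b) * complex.Im (f z))); last first.
  by apply/funext => x; case: (f x) => ? ?; rewrite /= mulNr.
rewrite (_ : (fun z => complex.Im _) = (fun z => a * complex.Im (f z) + b * complex.Re (f z))); last first.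
  by apply/funext => x; case: (f x).
rewrite !fs_intD ?fs_intZ//; try by apply: bmeasurableM => //; exact: bmeasurable_cst.
by apply/eqP; rewrite eq_complex/= mulNr !eqxx.
Qed.

Lemma fs_cint0 : fs_cint (fun=> 0 : R[i]) = 0.
Proof. by rewrite /fs_cint/= fs_int_cst. Qed.

Lemma fs_cint_sum (I : Type) (r : seq I) (f : I -> R[i] -> R[i]) :
  (forall i, cbmeasurable (f i)) ->
  fs_cint (fun z => \sum_(i <- r) f i z) = \sum_(i <- r) fs_cint (f i).
Proof.
move=> bf; elim: r => [|i r ih].
  by under eq_fun do rewrite big_nil; rewrite big_nil fs_cint0.
under eq_fun do rewrite big_cons; rewrite big_cons fs_cintD ?ih//.
exact: cbmeasurable_sum.
Qed.

Lemma fs_cint_real (r : R[i] -> R) : fs_cint (fun z => (r z)%:C) = (fs_int r)%:C.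
Proof. by rewrite /fs_cint/= fs_int_cst. Qed.

Lemma fs_cint_mobius (a b : R[i]) f : 0 < sqmod a + sqmod b -> cbmeasurable f ->
  fs_cint (fun z => f (mobius a b z)) = fs_cint f.
Proof.
move=> ab0 [f1 f2]; rewrite /fs_cint.
by rewrite (fs_int_mobius ab0 f1) (fs_int_mobius ab0 f2).
Qed.

Lemma eq_fs_cint_point (z0 : R[i]) f g :
  cmeasurable (fun w : P => f (cplx w)) -> cmeasurable (fun w : P => g (cplx w)) ->
  (forall z, z != z0 -> f z = g z) -> fs_cint f = fs_cint g.
Proof.
move=> /cmeasurableP[f1 f2] /cmeasurableP[g1 g2] fg; rewrite /fs_cint.
by congr (_ +i* _); apply: (eq_fs_int_point (z0 := z0)) => // z zz0; rewrite fg.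
Qed.

Lemma cbmeasurable_cmeasurable f : cbmeasurable f -> cmeasurable (fun w : P => f (cplx w)).
Proof. by move=> [[m1 _] [m2 _]]; exact/cmeasurableP. Qed.

End fs_int.

(** * Weighted inner products of sections *)

Section forms.
Context (R : realType).
Local Notation mu := (@lebesgue_measure R).
Local Notation P := (measurableTypeR R * measurableTypeR R)%type.

Lemma sqmod1 : sqmod (1 : R[i]) = 1.
Proof. by rewrite /sqmod/= expr0n/= addr0 expr1n. Qed.

Lemma sqmodX (z : R[i]) n : sqmod (z ^+ n) = sqmod z ^+ n.
Proof. by elim: n => [|n ih]; rewrite ?sqmod1// !exprS sqmodM ih. Qed.

Lemma sqmodV (z : R[i]) : sqmod z^-1 = (sqmod z)^-1.
Proof.
have [->|z0] := eqVneq z 0; first by rewrite invr0 sqmod0 invr0.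
have s0 : sqmod z != 0 by rewrite sqmod_eq0.
by apply: (mulIf s0); rewrite -sqmodM !mulVf// sqmod1.
Qed.

Lemma realV (x : R) : (x^-1)%:C = (x%:C)^-1 :> R[i].
Proof. by rewrite fmorphV. Qed.

Definition cmono (p i j : nat) (z : R[i]) : R[i] :=
  z ^+ i * conjc z ^+ j / ((1 + sqmod z) ^+ p)%:C.

Let one_sqmod_gt0 (z : R[i]) : 0 < 1 + sqmod z.
Proof. by rewrite ltr_pwDl ?sqmod_ge0. Qed.

Lemma cmeasurable_wden p : cmeasurable (fun w : P => (((1 + sqmod (cplx w)) ^+ p)%:C)^-1).
Proof.
apply: cmeasurableV; apply: cmeasurable_real; apply: measurable_funX.
by apply: measurable_funD => //; exact: measurable_sq.
Qed.

(** [cmono p i j] is the integrand of the inner product of [z^i] and [z^j] in O(p). The degree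
    bounds keep it bounded near infinity: each of the two powers of [sqmod z] in its squared modulus
    is at most [(1 + sqmod z) ^+ p]. *)
Lemma cbmeasurable_mono p i j : (i <= p)%N -> (j <= p)%N -> cbmeasurable (cmono p i j).
Proof.
move=> ip jp; apply: (@cbmeasurable_sqmod _ _ 1) => //.
  apply: cmeasurableM; last exact: cmeasurable_wden.
  apply: cmeasurableM; apply: cmeasurableX; first exact: cmeasurable_cplx.
  by apply: cmeasurable_conj; exact: cmeasurable_cplx.
move=> z; rewrite /cmono !sqmodM sqmodV sqmod_real !sqmodX sqmodJ expr1n.
rewrite ler_pdivrMr ?exprn_gt0// mul1r expr2.
have le (k : nat) : (k <= p)%N -> sqmod z ^+ k <= (1 + sqmod z) ^+ p.
  move=> kp; apply: (@le_trans _ _ ((1 + sqmod z) ^+ k)).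
    by rewrite lerXn2r ?nnegrE ?sqmod_ge0 ?lerDr ?ltW.
  by rewrite ler_weXn2l// lerDl sqmod_ge0.
by rewrite ler_pM ?exprn_ge0 ?sqmod_ge0 ?le.
Qed.

(** With weight 1 this is the L^2 inner product; with the indicator of a ball it is the sesquilinear
    form of the Toeplitz operator. *)
Definition wform (p : nat) (w : R[i] -> R) (q h : {poly R[i]}) : R[i] :=
  fs_cint (fun z => (w z)%:C * (q.[z] * conjc h.[z] / ((1 + sqmod z) ^+ p)%:C)).

Let integrand_expand p (q h : {poly R[i]}) z : (size q <= p.+1)%N -> (size h <= p.+1)%N ->
  q.[z] * conjc h.[z] / ((1 + sqmod z) ^+ p)%:C =
  \sum_(i < p.+1) \sum_(j < p.+1) (q`_i * conjc h`_j) * cmono p i j z.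
Proof.
move=> sq sh; rewrite (horner_coef_wide _ sq) (horner_coef_wide _ sh).
rewrite rmorph_sum/= big_distrlr/= mulr_suml; apply: eq_bigr => i _.
rewrite mulr_suml; apply: eq_bigr => j _.
by rewrite rmorphM rmorphXn/= /cmono !mulrA; congr (_ / _); ring.
Qed.

Lemma cbmeasurable_pair p (q h : {poly R[i]}) : (size q <= p.+1)%N -> (size h <= p.+1)%N ->
  cbmeasurable (fun z => q.[z] * conjc h.[z] / ((1 + sqmod z) ^+ p)%:C).
Proof.
move=> sq sh; apply: (cbmeasurable_ext (fun z => esym (integrand_expand z sq sh))).
apply: cbmeasurable_sum => i; apply: cbmeasurable_sum => j.
apply: cbmeasurableM; first exact: cbmeasurable_cst.
by apply: cbmeasurable_mono; rewrite -ltnS.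
Qed.

Lemma wform_expand p w (q h : {poly R[i]}) : bmeasurable w ->
  (size q <= p.+1)%N -> (size h <= p.+1)%N ->
  wform p w q h = \sum_(i < p.+1) \sum_(j < p.+1) (q`_i * conjc h`_j) *
    fs_cint (fun z => (w z)%:C * cmono p i j z).
Proof.
move=> bw sq sh.
have bm (i j : 'I_p.+1) : cbmeasurable (fun z => (w z)%:C * cmono p i j z).
  apply: cbmeasurableM; first exact: cbmeasurable_real.
  by apply: cbmeasurable_mono; rewrite -ltnS.
have bm2 (i j : 'I_p.+1) : cbmeasurable (fun z => (q`_i * conjc h`_j) * ((w z)%:C * cmono p i j z)).
  by apply: cbmeasurableM => //; exact: cbmeasurable_cst.
rewrite /wform.
under eq_fun => z.
  rewrite integrand_expand// mulr_sumr.
  under eq_bigr => i _.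
    rewrite mulr_sumr.
    under eq_bigr => j _ do rewrite mulrCA.
    over.
  over.
rewrite fs_cint_sum; last by move=> i; exact: cbmeasurable_sum.
apply: eq_bigr => i _; rewrite fs_cint_sum//; apply: eq_bigr => j _.
by rewrite fs_cintZ.
Qed.

Let root_of_minus_one (n : nat) : (0 < n)%N ->
  exists2 e : R[i], e ^+ n.*2 = -1 & sqmod e = 1.
Proof.
move=> n0; exists (n.*2.-root (-1)).
  by rewrite rootCK// double_gt0.
have : sqmod (n.*2.-root (-1) : R[i]) ^+ n.*2 = 1.
  by rewrite -sqmodX rootCK ?double_gt0// sqmodN sqmod1.
by move/eqP; rewrite pexpr_eq1 ?sqmod_ge0 ?double_gt0// => /eqP.
Qed.

Lemma height_pt (z : R[i]) : height (pt z) = sqmod z / (1 + sqmod z).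
Proof. by []. Qed.

(** The rotation [z |-> e^2 z], which is [mobius (conjc e) 0], preserves the integral and the weight
    but multiplies [cmono p i j] by [e^(2 (i - j))]. With [e] a unimodular root of -1 of order
    [2 |i - j|], the integral equals its opposite. *)
Lemma fs_cint_cmono_off p (w0 : R -> R) i j : i != j -> (i <= p)%N -> (j <= p)%N ->
  bmeasurable (fun z => w0 (height (pt z))) ->
  fs_cint (fun z => (w0 (height (pt z)))%:C * cmono p i j z) = 0.
Proof.
move=> ij ip jp bw.
pose f z := (w0 (height (pt z)))%:C * cmono p i j z.
have bf : cbmeasurable f.
  by apply: cbmeasurableM; [exact: cbmeasurable_real|exact: cbmeasurable_mono].
(* One of the truncated differences is 0, so [n] is the distance between [i] and [j]. *)
pose n := ((i - j) + (j - i))%N.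
have n0 : (0 < n)%N by rewrite /n addn_gt0 !subn_gt0 orbC -neq_ltn.
have [e en e1] := root_of_minus_one n0.
have e0 : e != 0 by rewrite -sqmod_eq0 e1 oner_eq0.
have ee : e * conjc e = 1 by rewrite mul_conjc e1.
have mobE z : mobius (conjc e) 0 z = e ^+ 2 * z.
  rewrite /mobius add0r conjcK rmorph0 mul0r subr0.
  have -> : (conjc e)^-1 = e by rewrite -[LHS]mul1r -ee mulfK// conjc_eq0.
  by rewrite mulrAC expr2.
have fe z : f (mobius (conjc e) 0 z) = -1 * f z.
  rewrite mobE /f /cmono !height_pt sqmodM sqmodX e1 expr1n mul1r.
  rewrite [RHS]mulrCA; congr (_ * _); rewrite [RHS]mulrA; congr (_ / _).
  rewrite rmorphM rmorphXn/= !exprMn mulrACA; congr (_ * _).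
  have eei k : e ^+ k * conjc e ^+ k = 1 by rewrite -exprMn ee expr1n.
  have enn : e ^+ n * e ^+ n = -1 by rewrite -exprD addnn en.
  have cnn : conjc e ^+ n * conjc e ^+ n = -1.
    by rewrite -rmorphXn -rmorphM/= enn rmorphN1.
  have [lij|lji] := leqP i j.
    have -> : conjc e ^+ j = conjc e ^+ n * conjc e ^+ i.
      by rewrite -exprD /n (eqP lij) subnK.
    transitivity ((e ^+ i * conjc e ^+ i) * (e ^+ i * conjc e ^+ i) * (conjc e ^+ n * conjc e ^+ n)).
      by ring.
    by rewrite eei cnn !mul1r.
  have -> : e ^+ i = e ^+ n * e ^+ j.
    by rewrite -exprD /n (eqP (ltnW lji)) addn0 subnK// ltnW.
  transitivity ((e ^+ j * conjc e ^+ j) * (e ^+ j * conjc e ^+ j) * (e ^+ n * e ^+ n)).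
    by ring.
  by rewrite eei enn !mul1r.
have := @fs_cint_mobius R (conjc e) 0 f.
rewrite sqmodJ e1 sqmod0 addr0 => /(_ ltr01 bf).
under eq_fun do rewrite fe.
rewrite fs_cintZ// mulN1r => /eqP; rewrite eq_sym -subr_eq0 opprK -mulr2n mulrn_eq0/=.
by move=> /eqP.
Qed.

(** [XMonemX k (p - k) s] is [s^k (1 - s)^(p - k)]. For [w0 = 1] the moment is a beta integral, the
    squared norm of the section [z^k]. *)
Definition radial_moment (p : nat) (w0 : R -> R) (k : nat) : R :=
  \int[mu]_(s in `[0, 1]) (w0 s * XMonemX k (p - k) s).

(** At [s = height (pt z)] one has [1 - s = 1 / (1 + sqmod z)], so [cmono p k k z] is
    [s^k (1 - s)^(p - k)], and [s] is uniformly distributed on [[0, 1]]. *)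
Lemma fs_cint_cmono_diag p (w0 : R -> R) k : (k <= p)%N ->
  measurable_fun [set: R] w0 -> (forall s, 0 <= w0 s) ->
  fs_cint (fun z => (w0 (height (pt z)))%:C * cmono p k k z) =
  (radial_moment p w0 k)%:C.
Proof.
move=> kp mw w00.
pose F s := w0 s * `|XMonemX k (p - k) s|.
have mF : measurable_fun [set: R] F.
  apply: measurable_funM => //; apply: measurableT_comp; first exact: normr_measurable.
  exact: measurable_XMonemX.
have F0 s : 0 <= F s by rewrite mulr_ge0.
have -> : radial_moment p w0 k = \int[mu]_(s in `[0, 1]) F s.
  apply: eq_Rintegral => s; rewrite inE/= => s01.
  by rewrite /F ger0_norm// XMonemX_ge0.
rewrite -fs_int_height// -fs_cint_real; congr fs_cint; apply/funext => z.
rewrite /F ger0_norm; last first.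
  by apply: XMonemX_ge0; rewrite in_itv/= height_ge0 ltW// height_lt1.
rewrite rmorphM; congr (_ * _).
rewrite /cmono -exprMn mul_conjc -rmorphXn -realV -rmorphM/=; congr (_%:C).
have -> (s : R) : XMonemX k (p - k) s = s ^+ k * (1 - s) ^+ (p - k) by [].
rewrite height_pt.
have s1 := gt_eqF (one_sqmod_gt0 z).
have -> : 1 - sqmod z / (1 + sqmod z) = (1 + sqmod z)^-1.
  by field; rewrite s1.
by rewrite exprMn -mulrA exprVn -exprVn -exprD subnKC// exprVn.
Qed.

Lemma wform_radial p (w0 : R -> R) (q h : {poly R[i]}) :
  measurable_fun [set: R] w0 -> (forall s, 0 <= w0 s) -> (forall s, w0 s <= 1) ->
  (size q <= p.+1)%N -> (size h <= p.+1)%N ->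
  wform p (fun z => w0 (height (pt z))) q h =
  \sum_(k < p.+1) (q`_k * conjc h`_k) * (radial_moment p w0 k)%:C.
Proof.
move=> mw w00 w01 sq sh.
have bw : bmeasurable (fun z => w0 (height (pt z))).
  split; last by exists 1 => z; rewrite ger0_norm.
  under eq_fun do rewrite cplxK.
  by apply: (measurableT_comp mw); exact: measurable_height.
rewrite wform_expand//; apply: eq_bigr => i _.
rewrite (bigD1 i)//= big1 ?addr0.
  by rewrite fs_cint_cmono_diag// -ltnS.
move=> j ji.
have H0 : fs_cint (fun z => (w0 (height (pt z)))%:C * cmono p i j z) = 0.
  apply: fs_cint_cmono_off => //; [|by rewrite -ltnS|by rewrite -ltnS].
  by rewrite eq_sym.
by rewrite H0 mulr0.
Qed.

End forms.

(** * Sections in a frame adapted to the centre *)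

Section mobius_forms.
Context (R : realType).
Local Notation mu := (@lebesgue_measure R).
Local Notation P := (measurableTypeR R * measurableTypeR R)%type.

(* Pull-back of a section of O(p) along [mobius a b], multiplied by
   (a - conjc b z)^p. *)
Definition mobius_poly (p : nat) (a b : R[i]) (q : {poly R[i]}) : {poly R[i]} :=
  \sum_(i < p.+1) q`_i *: ((b%:P + conjc a *: 'X) ^+ i * (a%:P - conjc b *: 'X) ^+ (p - i)).

Let size_affine (c d : R[i]) n : (size ((c%:P + d *: 'X) ^+ n) <= n.+1)%N.
Proof.
have s2 : (size (c%:P + d *: 'X)%R <= 2)%N.
  rewrite (leq_trans (size_polyD _ _))// geq_max (leq_trans (size_polyC_leq1 _))//=.
  by rewrite (leq_trans (size_scale_leq _ _))// size_polyX.
rewrite (leq_trans (size_poly_exp_leq _ _))// ltnS.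
by case: (size _) s2 => [|[|[]]]//= _; rewrite ?mul0n// mul1n.
Qed.

Lemma size_mobius_poly p a b q : (size (mobius_poly p a b q) <= p.+1)%N.
Proof.
apply: (leq_trans (size_sum _ _ _)); apply/bigmax_leqP => i _.
rewrite (leq_trans (size_scale_leq _ _))// (leq_trans (size_polyMleq _ _))//.
rewrite -scaleNr.
have := leq_add (size_affine b (conjc a) i) (size_affine a (- conjc b) (p - i)).
rewrite addSn addnS subnKC; last by rewrite -ltnS.
by move: (size _ + size _)%N => [|n].
Qed.

Lemma horner_mobius_poly p a b (q : {poly R[i]}) z : (size q <= p.+1)%N -> a - conjc b * z != 0 ->
  (mobius_poly p a b q).[z] = (a - conjc b * z) ^+ p * q.[mobius a b z].
Proof.
move=> sq d0; rewrite /mobius_poly horner_sum (horner_coef_wide _ sq) mulr_sumr.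
apply: eq_bigr => i _.
rewrite hornerZ hornerM !horner_exp !(hornerD, hornerN, hornerC, hornerZ, hornerX) [RHS]mulrCA.
congr (_ * _).
rewrite /mobius exprMn exprVn.
have -> : (a - conjc b * z) ^+ p = (a - conjc b * z) ^+ (p - i) * (a - conjc b * z) ^+ i.
  by rewrite -exprD subnK// -ltnS.
by rewrite mulrCA -mulrA mulfV ?expf_neq0// mulr1 mulrC.
Qed.

Let one_sqmod_gt0 (z : R[i]) : 0 < 1 + sqmod z.
Proof. by rewrite ltr_pwDl ?sqmod_ge0. Qed.

Lemma sqmod_unitary1 (a b z : R[i]) :
  sqmod (a - conjc b * z) + sqmod (b + conjc a * z) =
  (sqmod a + sqmod b) * (1 + sqmod z).
Proof. by case: a b z => a1 a2 [b1 b2] [u1 u2]; rewrite /sqmod/=; ring. Qed.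

Lemma one_sqmod_mobius (a b z : R[i]) : a - conjc b * z != 0 ->
  1 + sqmod (mobius a b z) = (sqmod a + sqmod b) * (1 + sqmod z) / sqmod (a - conjc b * z).
Proof.
move=> d0; have s0 : sqmod (a - conjc b * z) != 0 by rewrite sqmod_eq0.
by rewrite -sqmod_unitary1 mulrDl divff// /mobius sqmodM sqmodV.
Qed.

Lemma mobius_pole (a b z : R[i]) : 0 < sqmod a + sqmod b -> a - conjc b * z = 0 -> z = a / conjc b.
Proof.
move=> ab0 /eqP; rewrite subr_eq0 => /eqP abz.
have b0 : conjc b != 0.
  by apply: contraTneq ab0 => b0; rewrite abz b0 mul0r -(sqmodJ b) b0 !sqmod0 addr0 ltxx.
by rewrite abz mulrAC divff// mul1r.
Qed.

(** After the substitution [mobius a b], the power of [1 + sqmod z] in the metric acquires the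
    factor [(sqmod a + sqmod b)^p / sqmod (a - conjc b z)^p]. Its denominator is absorbed by
    [mobius_poly], and the remaining weight is radial. The coefficients are independent of the
    weight [w], so forms with different weights are diagonalised simultaneously. *)
Lemma wform_mobius p (a b : R[i]) (w : R[i] -> R) (w0 : R -> R) (q h : {poly R[i]}) :
  0 < sqmod a + sqmod b -> bmeasurable w ->
  measurable_fun [set: R] w0 -> (forall s, 0 <= w0 s) -> (forall s, w0 s <= 1) ->
  (forall z, a - conjc b * z != 0 -> w (mobius a b z) = w0 (height (pt z))) ->
  (size q <= p.+1)%N -> (size h <= p.+1)%N ->
  wform p w q h = (((sqmod a + sqmod b) ^+ p)^-1)%:C *
    \sum_(k < p.+1) ((mobius_poly p a b q)`_k * conjc (mobius_poly p a b h)`_k) *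
      (radial_moment p w0 k)%:C.
Proof.
move=> ab0 bw mw0 w00 w01 ww0 sq sh.
have sQ := size_mobius_poly p a b q; have sH := size_mobius_poly p a b h.
set Q := mobius_poly p a b q in sQ *; set H := mobius_poly p a b h in sH *.
have bw0 : bmeasurable (fun z : R[i] => w0 (height (pt z))).
  split; last by exists 1 => z; rewrite ger0_norm.
  under eq_fun do rewrite cplxK.
  by apply: (measurableT_comp mw0); exact: measurable_height.
rewrite -wform_radial// /wform.
pose F z := (w z)%:C * (q.[z] * conjc h.[z] / ((1 + sqmod z) ^+ p)%:C).
have bF : cbmeasurable F.
  by apply: cbmeasurableM; [exact: cbmeasurable_real|exact: cbmeasurable_pair].
pose G z := (w0 (height (pt z)))%:C * (Q.[z] * conjc H.[z] / ((1 + sqmod z) ^+ p)%:C).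
have bG : cbmeasurable G.
  by apply: cbmeasurableM; [exact: cbmeasurable_real|exact: cbmeasurable_pair].
rewrite -fs_cintZ// -(fs_cint_mobius ab0 bF).
apply: (eq_fs_cint_point (z0 := a / conjc b)).
- rewrite /cmeasurable (_ : (fun w => _) = (fun w : P => pt (F (cplx w))) \o (fun w => pt (mobius a b (cplx w)))).
    apply: measurableT_comp; first exact: (cbmeasurable_cmeasurable bF).
    exact: cmeasurable_mobius.
  by apply/funext => x /=; rewrite ptK.
- apply: cmeasurableM; first exact: cmeasurable_cst.
  exact: (cbmeasurable_cmeasurable bG).
move=> z zp; have d0 : a - conjc b * z != 0.
  by apply: contra_neq zp; exact: mobius_pole.
rewrite /F /G ww0// [RHS]mulrCA; congr (_ * _).
rewrite /Q /H !horner_mobius_poly// one_sqmod_mobius//.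
set d := a - conjc b * z in d0 *; set k := sqmod a + sqmod b in ab0 *.
move: (q.[_]) (h.[_]) => A B.
have -> : ((k * (1 + sqmod z) / sqmod d) ^+ p)%:C =
    (k ^+ p)%:C * ((1 + sqmod z) ^+ p)%:C / (d ^+ p * conjc d ^+ p).
  have -> : d ^+ p * conjc d ^+ p = (sqmod d ^+ p)%:C by rewrite -exprMn mul_conjc rmorphXn.
  by rewrite expr_div_n exprMn -realV -!rmorphM.
have cE : conjc (d ^+ p * B) = conjc d ^+ p * conjc B by rewrite rmorphM rmorphXn.
rewrite realV cE.
have kp0 : (k ^+ p)%:C != 0 by rewrite fmorph_eq0 expf_neq0// gt_eqF.
have tp0 : ((1 + sqmod z) ^+ p)%:C != 0 by rewrite fmorph_eq0 expf_neq0// gt_eqF.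
have dp0 : d ^+ p != 0 by rewrite expf_neq0.
have cp0 : conjc d ^+ p != 0 by rewrite expf_neq0// conjc_eq0.
move: (k ^+ p)%:C ((1 + sqmod z) ^+ p)%:C (d ^+ p) (conjc d ^+ p) (conjc B) kp0 tp0 dp0 cp0.
move=> K T D D' B' K0 T0 D0 D'0.
by field; rewrite K0 T0 D0 D'0.
Qed.

(* The section (b - a z)^p, which vanishes to order p at the point b / a. *)
Definition vanishing_section (p : nat) (a b : R[i]) : H0 R p :=
  npolyp p.+1 (\poly_(i < p.+1) (b ^+ (p - i) * (- a) ^+ i *+ 'C(p, i))).

(** The binomial expansion of the [p]-th power of [b (a - conjc b X) - a (b + conjc a X) = - (sqmod
    a + sqmod b) X]. Thus this section corresponds to the top monomial, the one most concentrated
    away from the centre. *)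
Lemma mobius_vanishing_section p a b :
  mobius_poly p a b (val (vanishing_section p a b)) =
  (- (sqmod a + sqmod b)%:C) ^+ p *: 'X^p.
Proof.
rewrite -exprZn /mobius_poly.
have -> : - (sqmod a + sqmod b)%:C *: 'X =
    b *: (a%:P - conjc b *: 'X) + (- a) *: (b%:P + conjc a *: 'X) :> {poly R[i]}.
  rewrite rmorphD/= -!mul_conjc -!mul_polyC !polyCN !polyCD !polyCM.
  by ring.
rewrite exprDn; apply: eq_bigr => i _.
rewrite coef_npolyp ltn_ord coef_poly ltn_ord !exprZn.
rewrite -scalerAl -scalerAr scalerA -scalerMnl.
by congr (_ *+ _); rewrite mulrC; congr (_ *: _); exact: mulrC.
Qed.

End mobius_forms.

(** * Moments over an initial segment of the unit interval *)

Section moments.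
Context (R : realType).
Local Notation mu := (@lebesgue_measure R).
Variables (J : set R) (v : R).
Hypotheses (mJ : measurable J) (v01 : 0 < v <= 1).
(** Within [[0, 1]] these conditions leave only the membership of the endpoint [v] undecided. *)
Hypotheses (J1 : forall s, 0 <= s < v -> J s) (J2 : forall s, J s -> s <= v).

Let scaled_itv t : 0 <= t -> t <= 1 -> v * t \in `[0, 1].
Proof.
have /andP[v0 v1] := v01.
by move=> t0 t1; rewrite in_itv/= mulr_ge0 ?(ltW v0)//= mulr_ile1// ltW.
Qed.

Let scaled_integrable a b : mu.-integrable `[0, 1] (EFin \o (fun t : R => XMonemX a b (v * t))).
Proof.
apply: measurable_bounded_integrable => //.
- by rewrite /= lebesgue_measure_itv/= lte_fin ltr01 -EFinB ltry.
- apply: measurable_funTS.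
  apply: (measurableT_comp (measurable_XMonemX (A := setT) a b)).
  exact: measurable_funM.
exists 1; split => // M M1 t /=; rewrite in_itv/= => /andP[t0 t1].
have vt := scaled_itv t0 t1.
by rewrite ger0_norm ?XMonemX_ge0// (le_trans (XMonemX_le1 _ _ vt))// ltW.
Qed.

Lemma radial_moment_indic p k :
  radial_moment p (\1_J) k = v * \int[mu]_(t in `[0, 1]) XMonemX k (p - k) (v * t).
Proof.
have /andP[v0 v1] := v01.
have vn0 : v != 0 by rewrite gt_eqF.
pose X := XMonemX k (p - k) : R -> R.
have mX : measurable_fun [set: R] X by exact: measurable_XMonemX.
pose f (s : R) : R := \1_J s * \1_(`[0, 1]%classic) s * `|X s|.
have mf : measurable_fun [set: R] f.
  apply: measurable_funM; first by apply: measurable_funM; exact: measurable_indic.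
  by apply: measurableT_comp => //; exact: normr_measurable.
have f0 s : 0 <= f s by rewrite !mulr_ge0.
pose g (t : R) : R := \1_(`[0, 1]%classic) t * `|X (v * t)|.
have mg : measurable_fun [set: R] g.
  apply: measurable_funM; first exact: measurable_indic.
  apply: measurableT_comp; first exact: normr_measurable.
  by apply: (measurableT_comp mX); exact: measurable_funM.
have E : (\int[mu]_s (f s)%:E = v%:E * \int[mu]_t (g t)%:E)%E.
  rewrite (ge0_integral_affine 0 vn0); last 2 first.
  - exact/measurable_EFinP.
  - by move=> s; rewrite lee_fin.
  rewrite gtr0_norm//; congr (_ * _)%E.
  (* [t = 1] corresponds to the undecided endpoint [s = v]. *)
  apply: (eq_integral_outside (mu := @lebesgue_measure R) (N := [set 1])).
  - exact: measurable_set1.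
  - exact: lebesgue_measure_set1.
  - apply/measurable_EFinP; apply: (measurableT_comp mf).
    by apply: measurable_funD => //; exact: measurable_funM.
  - exact/measurable_EFinP.
  move=> t /= /eqP t1; rewrite addr0 /f /g; congr (_ * _)%:E.
  rewrite !indicE -natrM mulnb; congr ((_ : bool)%:R).
  apply/idP/idP.
    move=> /andP[/set_mem /J2 vtv]; rewrite !inE/= !in_itv/= => /andP[vt0 _].
    by rewrite -(pmulr_rge0 _ v0) vt0/= -(ler_pM2l v0) mulr1.
  rewrite !inE/= !in_itv/= => /andP[t0 tle1].
  have tlt1 : t < 1 by rewrite lt_neqAle t1.
  have := scaled_itv t0 tle1; rewrite in_itv/= => vt.
  apply/andP; split; last by rewrite inE/= in_itv/=.
  by rewrite inE; apply: J1; case/andP: vt => -> _ /=; rewrite -[ltRHS]mulr1 ltr_pM2l.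
rewrite /radial_moment.
have -> : \int[mu]_(s in `[0, 1]) (\1_J s * XMonemX k (p - k) s) = fine (\int[mu]_s (f s)%:E)%E.
  rewrite Rintegral_mkcond /Rintegral; congr fine; apply: eq_integral => s _.
  rewrite patchE /f [\1_(`[0, 1]%classic) s]indicE; case: ifPn => s01; last by rewrite mulr0 mul0r.
  by rewrite mulr1 ger0_norm// XMonemX_ge0//; move: s01; rewrite inE.
have -> : \int[mu]_(t in `[0, 1]) XMonemX k (p - k) (v * t) = fine (\int[mu]_t (g t)%:E)%E.
  rewrite Rintegral_mkcond /Rintegral; congr fine; apply: eq_integral => t _.
  rewrite patchE /g indicE; case: ifPn => t01; last by rewrite mul0r.
  rewrite mul1r ger0_norm// XMonemX_ge0//; move: t01; rewrite inE/= in_itv/= => /andP[t0 t1].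
  exact: scaled_itv.
(* Infinite values need no separate exclusion: multiplication by [v > 0] keeps them infinite, and
   [fine] sends them to 0. *)
rewrite E; case: (\int[mu]_t _)%E => [r| |]//=.
  by rewrite gt0_muley ?lte_fin//= mulr0.
by rewrite gt0_muleNy ?lte_fin//= mulr0.
Qed.

Lemma radial_moment1 p k :
  radial_moment p (cst 1) k = \int[mu]_(t in `[0, 1]) XMonemX k (p - k) t.
Proof. by apply: eq_Rintegral => s _; rewrite mul1r. Qed.

Lemma radial_moment1_gt0 p k : 0 < radial_moment p (cst (1 : R)) k.
Proof.
(* The parameters of the beta function exceed the exponents by one. *)
have := @beta_fun_gt0 R k.+1 (p - k).+1; rewrite /beta_fun/= -Rintegral_mkcond.
by rewrite radial_moment1.
Qed.

Let ge_scaled p k t : (k <= p)%N -> 0 <= t -> t <= 1 ->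
  v ^+ p * XMonemX k (p - k) t <= XMonemX k (p - k) (v * t).
Proof.
move=> kp t0 t1; have /andP[v0 v1] := v01.
have XE (s : R) : XMonemX k (p - k) s = s ^+ k * (1 - s) ^+ (p - k) by [].
have -> : v ^+ p * XMonemX k (p - k) t = (v * t) ^+ k * (v * (1 - t)) ^+ (p - k).
  by rewrite XE !exprMn mulrACA -exprD subnKC.
have vt0 : 0 <= v * t by rewrite mulr_ge0// ltW.
have vt1 : 0 <= v * (1 - t) by rewrite mulr_ge0 ?(ltW v0)// subr_ge0.
have le1 : v * (1 - t) <= 1 - v * t by rewrite mulrBr mulr1 lerD2r.
rewrite XE ler_wpM2l ?exprn_ge0// lerXn2r// nnegrE//.
exact: le_trans le1.
Qed.

Lemma radial_moment_ge p k : (k <= p)%N ->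
  v ^+ p.+1 * radial_moment p (cst 1) k <= radial_moment p (\1_J) k.
Proof.
move=> kp; have /andP[v0 v1] := v01.
rewrite radial_moment_indic exprS -mulrA ler_pM2l// radial_moment1.
rewrite -RintegralZl//; last exact: integrable_XMonemX.
apply: le_Rintegral => //.
  exact: (integrableZl _ _ (integrable_XMonemX k (p - k))).
by move=> t /=; rewrite in_itv/= => /andP[t0 t1]; exact: ge_scaled.
Qed.

Lemma radial_moment_top p :
  radial_moment p (\1_J) p = v ^+ p.+1 * radial_moment p (cst 1) p.
Proof.
rewrite radial_moment_indic exprS -mulrA; congr (_ * _).
rewrite radial_moment1 -RintegralZl//; last exact: integrable_XMonemX.
by apply: eq_Rintegral => t _; rewrite subnn !XMonemXn0 exprMn.
Qed.

End moments.

(** * Spectrum *)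

Section spectrum.
Context (R : realType) (p : nat).
Local Notation H0p := (H0 R p).
Variable chi : R[i] -> R.
Hypothesis bchi : bmeasurable chi.

Let b1 : bmeasurable (fun=> 1 : R). Proof. exact: bmeasurable_cst. Qed.

Let szq (q : H0p) : (size (val q) <= p.+1)%N. Proof. exact: size_npoly. Qed.

Let mom k : R := radial_moment p (cst 1) k.

Let mom0 k : (mom k)%:C != 0.
Proof. by rewrite fmorph_eq0 gt_eqF// radial_moment1_gt0. Qed.

Lemma wform_one (q h : {poly R[i]}) : (size q <= p.+1)%N -> (size h <= p.+1)%N ->
  wform p (fun=> 1) q h =
  \sum_(k < p.+1) (q`_k * conjc h`_k) * (radial_moment p (cst 1) k)%:C.
Proof. by move=> sq sh; rewrite -(wform_radial (w0 := cst 1)). Qed.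

(** Antilinearity in [h], so that testing against monomials is enough. *)
Lemma wform_coef (q h : {poly R[i]}) : (size q <= p.+1)%N -> (size h <= p.+1)%N ->
  wform p chi q h = \sum_(k < p.+1) conjc h`_k * wform p chi q 'X^k.
Proof.
move=> sq sh; rewrite wform_expand// exchange_big/=; apply: eq_bigr => k _.
rewrite wform_expand//; last by rewrite size_polyXn.
rewrite mulr_sumr; apply: eq_bigr => i _.
rewrite (bigD1 k)//= big1 ?addr0.
  by rewrite coefXn eqxx conjc1 mulr1 mulrCA mulrA.
move=> j jk; rewrite coefXn (_ : (val j == val k) = false) ?conjc0 ?mulr0 ?mul0r//.
by apply/negbTE; rewrite val_eqE.
Qed.

Lemma l2_inner_wform (q g t : {poly R[i]}) :
  (size q <= p.+1)%N -> (size g <= p.+1)%N -> (size t <= p.+1)%N ->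
  l2_inner p (fun z => (chi z)%:C * q.[z] - g.[z]) (fun z => t.[z]) =
  wform p chi q t - wform p (fun=> 1) g t.
Proof.
move=> sq sg st; rewrite /wform.
have bq : cbmeasurable (fun z => (chi z)%:C * (q.[z] * conjc t.[z] / ((1 + sqmod z) ^+ p)%:C)).
  by apply: cbmeasurableM; [exact: cbmeasurable_real|exact: cbmeasurable_pair].
have bg : cbmeasurable (fun z => 1%:C * (g.[z] * conjc t.[z] / ((1 + sqmod z) ^+ p)%:C)).
  by apply: cbmeasurableM; [exact: cbmeasurable_cst|exact: cbmeasurable_pair].
rewrite -[X in _ + X]mulN1r -fs_cintZ// -fs_cintD//; last first.
  by apply: cbmeasurableM => //; exact: cbmeasurable_cst.
by rewrite /l2_inner; congr fs_cint; apply/funext => z; rewrite rmorph1 !mul1r; ring.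
Qed.

Let is_proj (q g : H0p) := forall t : H0p,
  l2_inner p (fun z => (chi z)%:C * (val q).[z] - (val g).[z]) (fun z => (val t).[z]) = 0.

Let is_projE q g : is_proj q g <-> forall t : H0p,
  wform p chi (val q) (val t) = wform p (fun=> 1) (val g) (val t).
Proof.
split=> h t; have := h t; rewrite l2_inner_wform//.
  by move=> /eqP; rewrite subr_eq0 => /eqP.
by move=> ->; rewrite subrr.
Qed.

Let proj_exists q : exists g, is_proj q g.
Proof.
(* The monomials are orthogonal with squared norms [mom k], so these are the Fourier coefficients of
   the weighted section. *)
pose g : H0p := npolyp p.+1 (\poly_(k < p.+1) (wform p chi (val q) 'X^k / (mom k)%:C)).
exists g; apply/is_projE => t; rewrite wform_coef// wform_one//; apply: eq_bigr => k _.
by rewrite coef_npolyp ltn_ord coef_poly ltn_ord mulrAC divfK// mulrC.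
Qed.

Let proj_unique q g g' : is_proj q g -> is_proj q g' -> g = g'.
Proof.
move=> /is_projE h /is_projE h'; apply/npolyP => k.
have [kp|kp] := ltnP k p.+1; last by rewrite !big_coef_npoly.
pose t : H0p := npolyp p.+1 'X^k.
have tE : val t = 'X^k by apply: npolypK; rewrite size_polyXn.
have coefE (u : H0p) : wform p (fun=> 1) (val u) (val t) = u`_k * (mom k)%:C.
  rewrite wform_one// tE (bigD1 (Ordinal kp))//= big1 ?addr0.
    by rewrite coefXn eqxx conjc1 mulr1.
  move=> j jk; rewrite coefXn (_ : (val j == k) = false) ?conjc0 ?mulr0 ?mul0r//.
  by apply/negbTE; move: jk; rewrite -val_eqE.
have := h t; rewrite h' !coefE => /(mulIf (mom0 k)) ->.
by [].
Qed.

(** Existence excludes the default value of [xget], and uniqueness identifies its choice; the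
    projection is then handled only through this weak characterisation. *)
Lemma bergman_projP (q g : H0p) :
  bergman_proj p (fun z => (chi z)%:C * (val q).[z]) = g <->
  forall t : H0p, wform p chi (val q) (val t) = wform p (fun=> 1) (val g) (val t).
Proof.
have [g0 hg0] := proj_exists q.
have hT : is_proj q (bergman_proj p (fun z => (chi z)%:C * (val q).[z])).
  by rewrite /bergman_proj; case: xgetP => [y _ //|/(_ g0)].
move: (bergman_proj _ _) hT => G hT; split=> [<-|h]; first by move/is_projE: hT.
by apply: (proj_unique hT); apply/is_projE.
Qed.

Lemma wform_one_gt0 (q : H0p) : q != 0 -> 0 < wform p (fun=> 1) (val q) (val q).
Proof.
move=> q0; rewrite wform_one//.
have [k qk] : exists k : 'I_p.+1, q`_k != 0.
  apply/existsP; apply: contraNT q0; rewrite negb_exists => /forallP q0.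
  apply/eqP/npolyP => k; rewrite coef0.
  have [kp|kp] := ltnP k p.+1; last by rewrite big_coef_npoly.
  by have := q0 (Ordinal kp); rewrite negbK => /eqP.
have ge0 j : 0 <= (q`_j * conjc q`_j) * (radial_moment p (cst 1) j)%:C.
  by rewrite mulr_ge0 ?mulcJ_ge0// ler0c ltW// radial_moment1_gt0.
rewrite (bigD1 k)//= ltr_pwDl ?sumr_ge0// lt_neqAle ge0 andbT eq_sym.
by rewrite !mulf_neq0// ?conjc_eq0//; exact: mom0.
Qed.

Lemma wform_oneZl (l : R[i]) (q h : {poly R[i]}) : (size q <= p.+1)%N -> (size h <= p.+1)%N ->
  wform p (fun=> 1) (l *: q) h = l * wform p (fun=> 1) q h.
Proof.
move=> sq sh; rewrite !wform_one// ?(leq_trans (size_scale_leq _ _))// mulr_sumr.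
by apply: eq_bigr => k _; rewrite coefZ !mulrA.
Qed.

End spectrum.

(** * Volume and spectrum of a spherical cap *)

Section ball_spectrum.
Context (R : realType).
Variables (a b : R[i]) (J : set R) (v : R) (B : set (CP1 R)).
Hypotheses (ab0 : 0 < sqmod a + sqmod b).
Hypotheses (mJ : measurable J) (v01 : 0 < v <= 1).
Hypotheses (J1 : forall s, 0 <= s < v -> J s) (J2 : forall s, J s -> s <= v).

(* The squared sine of the angle between x and [a : b], as lines in C^2. *)
Definition sdist (a b : R[i]) (x : CP1 R) : R :=
  match x with
  | Some z => sqmod (a * z - b) / ((sqmod a + sqmod b) * (1 + sqmod z))
  | None => sqmod a / (sqmod a + sqmod b)
  end.

Hypothesis BE : forall x, B x <-> J (sdist a b x).

Local Notation P := (measurableTypeR R * measurableTypeR R)%type.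

Let chi (z : R[i]) : R := \1_B (Some z).

(** Unitary maps preserve angles and [mobius a b] sends 0 to the centre; concretely,
    [a * mobius a b z - b] equals [(sqmod a + sqmod b) z / (a - conjc b z)]. *)
Lemma sdist_mobius z : a - conjc b * z != 0 ->
  sdist a b (Some (mobius a b z)) = height (pt z).
Proof.
move=> d0; rewrite /sdist one_sqmod_mobius// height_pt.
have k_gt0 := ab0; set k := sqmod a + sqmod b in k_gt0 *; set d := a - conjc b * z in d0 *.
have -> : a * mobius a b z - b = k%:C * z / d.
  rewrite /mobius -/d mulrA; apply: (mulIf d0); rewrite mulrBl !divfK//.
  by rewrite /k rmorphD/= -!mul_conjc /d; ring.
rewrite !sqmodM sqmodV sqmod_real.
have sd0 : sqmod d != 0 by rewrite sqmod_eq0.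
have k0 : k != 0 by rewrite gt_eqF.
have t0 : 1 + sqmod z != 0 by rewrite gt_eqF// ltr_pwDl ?sqmod_ge0.
by field; rewrite sd0 k0 t0.
Qed.

Let mem_ball x : (x \in B) = (sdist a b x \in J).
Proof. by apply/idP/idP; rewrite !inE => h; apply/BE. Qed.

Let chi_mobius z : a - conjc b * z != 0 -> chi (mobius a b z) = \1_J (height (pt z)).
Proof.
move=> d0; by rewrite /chi !indicE mem_ball sdist_mobius.
Qed.

Lemma bmeasurable_ball : bmeasurable (fun z => \1_B (Some z) : R).
Proof.
split; last by exists 1 => z; rewrite /chi indicE; case: (_ \in _); rewrite ?normr1 ?normr0.
have msd : measurable_fun [set: P] (fun w => sdist a b (Some (cplx w))).
  apply: measurable_funM.
    apply: measurable_sqmod; apply: cmeasurableD; last exact: cmeasurable_cst.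
    by apply: cmeasurableM; [exact: cmeasurable_cst|exact: cmeasurable_cplx].
  apply: measurable_ge0_funV; last first.
    by move=> w; rewrite mulr_ge0 ?(ltW ab0)// addr_ge0 ?sqmod_ge0.
  apply: measurable_funM => //; apply: measurable_funD => //; exact: measurable_sq.
rewrite (_ : (fun w => _) = (\1_J : R -> R) \o (fun w : P => sdist a b (Some (cplx w)))).
  by apply: measurableT_comp => //; exact: measurable_indic.
by apply/funext => w; rewrite /chi/= !indicE mem_ball.
Qed.

Let bchi : bmeasurable chi := bmeasurable_ball.
Let mI : measurable_fun [set: R] (\1_J : R -> R). Proof. exact: measurable_indic. Qed.
Let I0 s : 0 <= \1_J s :> R. Proof. by []. Qed.
Let I1 s : \1_J s <= 1 :> R. Proof. by rewrite indicE; case: (_ \in _). Qed.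

Lemma fs_vol_ball : fs_vol B = v.
Proof.
have -> : fs_vol B = fs_int chi by [].
have cm1 : fs_int chi = fs_int (fun z => \1_J (height (pt z))).
  rewrite -(fs_int_mobius ab0 bchi); apply: (eq_fs_int_point (z0 := a / conjc b)).
  - rewrite (_ : (fun w => _) = (fun w : P => chi (cplx w)) \o (fun w => pt (mobius a b (cplx w)))).
      by apply: measurableT_comp; [case: bchi|exact: cmeasurable_mobius].
    by apply/funext => w /=; rewrite ptK.
  - under eq_fun do rewrite cplxK.
    by apply: (measurableT_comp mI); exact: measurable_height.
  move=> z zp; apply: chi_mobius; apply: contra_neq zp; exact: mobius_pole.
rewrite cm1 (fs_int_height mI I0).
have := radial_moment_top mJ v01 J1 J2 0.
rewrite /radial_moment/= subnn expr1.
under eq_Rintegral do rewrite XMonemX00 mulr1.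
move=> ->; under eq_Rintegral do rewrite XMonemX00 mulr1.
by rewrite Rintegral_cst//= lebesgue_measure_itv/= lte_fin ltr01 oppr0 adde0 mulr1 mulr1.
Qed.

(** Testing the eigenvalue equation against the eigenvector itself expresses [l] as a quotient of
    two diagonal forms with the same nonnegative coefficients, and the moments are compared term by
    term. The order being that of [R[i]], the inequality also shows that [l] is real. *)
Lemma ball_spec_is_min (p : nat) :
  is_min (spec (@toeplitz R p (fun x => (\1_B x)%:C))) ((v ^+ p.+1)%:C).
Proof.
have kp0 : 0 < (((sqmod a + sqmod b) ^+ p)^-1)%:C :> R[i].
  by rewrite (_ : 0 = 0%:C)// ltcR invr_gt0 exprn_gt0.
have one_mob z : a - conjc b * z != 0 -> (1 : R) = (cst 1 : R -> R) (height (pt z)) by [].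
have fe (q h : H0 R p) := wform_mobius ab0 bchi mI I0 I1 chi_mobius (size_npoly q) (size_npoly h).
have f1 (q h : H0 R p) := wform_mobius (w := fun=> 1) (w0 := cst 1) ab0 (bmeasurable_cst 1)
  (measurable_cst _) (fun=> ler01) (fun=> lexx 1) one_mob (size_npoly q) (size_npoly h).
have eigP (l : R[i]) (q : H0 R p) : toeplitz (fun x => (\1_B x)%:C) q = l *: q <->
    forall t : H0 R p, wform p chi (val q) (val t) = l * wform p (fun=> 1) (val q) (val t).
  rewrite /toeplitz -[X in X = _ <-> _]/(bergman_proj p (fun z => (chi z)%:C * (val q).[z])).
  rewrite (bergman_projP bchi); split=> h t; rewrite h ?wform_oneZl ?size_npoly//.
split.
  exists (vanishing_section p a b).
    (* If the section were 0, so would be its transform, a non-zero multiple of ['X^p]. *)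
    apply/eqP => q0; have := mobius_vanishing_section p a b; rewrite q0.
    rewrite /mobius_poly big1 => [/esym/eqP|i _]; last by rewrite coef0 scale0r.
    rewrite scaler_eq0 -size_poly_eq0 size_polyXn orbF expf_eq0 oppr_eq0 fmorph_eq0.
    by rewrite (gt_eqF ab0) andbF.
  (* The transformed section has only its coefficient of index [p], where the two moments differ by
     exactly the factor [v ^+ p.+1]. *)
  apply/eigP => t; rewrite fe f1 mobius_vanishing_section [RHS]mulrCA; congr (_ * _).
  rewrite mulr_sumr; apply: eq_bigr => k _; rewrite coefZ coefXn.
  have [kp|kp] := eqVneq (k : nat) p; last by rewrite mulr0 !mul0r mulr0.
  by rewrite kp (radial_moment_top mJ v01 J1 J2) rmorphM/= mulr1; ring.
move=> l [q q0] /eigP /(_ q).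
have pos := wform_one_gt0 q0.
rewrite fe => e1; rewrite -(ler_pM2r pos) -e1 f1 mulrCA ler_pM2l// mulr_sumr.
apply: ler_sum => k _; rewrite mulrCA ler_wpM2l ?mulcJ_ge0// -rmorphM/= lecR.
by apply: radial_moment_ge; rewrite // -ltnS.
Qed.

End ball_spectrum.

(** * Geodesic balls *)

Section velocities.
Context (R : realType).
Implicit Types (u w : R -> R[i]).

(** A relational form of [C1_curve] and [velocity]: the derivative is carried along, so linear
    combinations and changes of speed are differentiated by composing lemmas. *)
Definition has_velocity u u' :=
  [/\ forall t : R, is_derive t (1 : R) (fun s => complex.Re (u s)) (complex.Re (u' t)),
      forall t : R, is_derive t (1 : R) (fun s => complex.Im (u s)) (complex.Im (u' t)),
      continuous (fun t => complex.Re (u' t)) &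
      continuous (fun t => complex.Im (u' t))].

Lemma C1_curve_velocity u : C1_curve u -> has_velocity u (velocity u).
Proof.
by move=> [d1 d2 c1 c2]; split=> //= t; rewrite derive1E; apply/derivableP.
Qed.

Lemma has_velocityE u u' : has_velocity u u' -> C1_curve u /\ velocity u = u'.
Proof.
move=> [d1 d2 c1 c2].
have e1 : derive1 (fun s => complex.Re (u s)) = fun t => complex.Re (u' t).
  by apply/funext => t; rewrite derive1E; apply: derive_val.
have e2 : derive1 (fun s => complex.Im (u s)) = fun t => complex.Im (u' t).
  by apply/funext => t; rewrite derive1E; apply: derive_val.
split; first by split; rewrite ?e1 ?e2//.
by apply/funext => t; rewrite /velocity e1 e2; case: (u' t).
Qed.

Lemma has_velocity_cst (c : R[i]) : has_velocity (fun=> c) (fun=> 0).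
Proof.
by split=> [t|t|t|t]; [exact: is_derive_cst|exact: is_derive_cst|exact: cvg_cst|exact: cvg_cst].
Qed.

Lemma has_velocityD u u' w w' : has_velocity u u' -> has_velocity w w' ->
  has_velocity (fun t => u t + w t) (fun t => u' t + w' t).
Proof.
move=> [d1 d2 c1 c2] [e1 e2 f1 f2]; split=> t.
- rewrite raddfD (_ : (fun s => _) = (fun s => complex.Re (u s)) + (fun s => complex.Re (w s))); first exact: is_deriveD.
  by apply/funext => s; rewrite raddfD.
- rewrite raddfD (_ : (fun s => _) = (fun s => complex.Im (u s)) + (fun s => complex.Im (w s))); first exact: is_deriveD.
  by apply/funext => s; rewrite raddfD.
- by rewrite /continuous_at raddfD; under eq_fun do rewrite raddfD; apply: cvgD; [exact: c1|exact: f1].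
- by rewrite /continuous_at raddfD; under eq_fun do rewrite raddfD; apply: cvgD; [exact: c2|exact: f2].
Qed.

Lemma has_velocityZ (c : R[i]) u u' : has_velocity u u' ->
  has_velocity (fun t => c * u t) (fun t => c * u' t).
Proof.
have ReM (x y : R[i]) : complex.Re (x * y) = complex.Re x * complex.Re y - complex.Im x * complex.Im y by case: x => ? ?; case: y.
have ImM (x y : R[i]) : complex.Im (x * y) = complex.Re x * complex.Im y + complex.Im x * complex.Re y by case: x => ? ?; case: y.
move=> [d1 d2 c1 c2]; split=> t.
- rewrite ReM (_ : (fun s => _) = complex.Re c *: (fun s => complex.Re (u s)) - complex.Im c *: (fun s => complex.Im (u s))).
    by apply: is_deriveB.
  by apply/funext => s; rewrite ReM.
- rewrite ImM (_ : (fun s => _) = complex.Re c *: (fun s => complex.Im (u s)) + complex.Im c *: (fun s => complex.Re (u s))).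
    by apply: is_deriveD.
  by apply/funext => s; rewrite ImM.
- rewrite /continuous_at ReM; under eq_fun do rewrite ReM.
  by apply: cvgB; (apply: cvgM; [exact: cvg_cst|]); [exact: c1|exact: c2].
- rewrite /continuous_at ImM; under eq_fun do rewrite ImM.
  by apply: cvgD; (apply: cvgM; [exact: cvg_cst|]); [exact: c2|exact: c1].
Qed.

Lemma has_velocity_scale (k : R) u u' : has_velocity u u' ->
  has_velocity (fun t => u (k * t)) (fun t => k%:C * u' (k * t)).
Proof.
have ReM (y : R[i]) : complex.Re (k%:C * y) = complex.Re y * k by case: y => y1 y2 /=; ring.
have ImM (y : R[i]) : complex.Im (k%:C * y) = complex.Im y * k by case: y => y1 y2 /=; ring.
have dk (t : R) : is_derive t (1 : R) (fun s : R => k * s) k.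
  have := @is_deriveZ R R R id k t 1 1 _; rewrite /GRing.scale/= mulr1; apply; exact: is_derive_id.
have ck t : (fun s : R => k * s) @ t --> k * t by exact: mulrl_continuous.
move=> [d1 d2 c1 c2]; split=> t.
- rewrite ReM; exact: (@is_derive1_comp R (fun s => complex.Re (u s)) (fun s => k * s)).
- rewrite ImM; exact: (@is_derive1_comp R (fun s => complex.Im (u s)) (fun s => k * s)).
- rewrite /continuous_at ReM; under eq_fun do rewrite ReM; apply: cvgM; last exact: cvg_cst.
  exact: (continuous_comp (ck t) (c1 _)).
- rewrite /continuous_at ImM; under eq_fun do rewrite ImM; apply: cvgM; last exact: cvg_cst.
  exact: (continuous_comp (ck t) (c2 _)).
Qed.

Lemma has_velocity_id : has_velocity (fun t : R => t%:C) (fun=> 1).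
Proof.
by split=> [t|t|t|t] /=; [exact: is_derive_id|exact: is_derive_cst|exact: cvg_cst|exact: cvg_cst].
Qed.

Lemma has_velocity_continuous u u' : has_velocity u u' ->
  continuous (fun t => complex.Re (u t)) /\ continuous (fun t => complex.Im (u t)).
Proof.
move=> [d1 d2 _ _].
by split=> t; apply: differentiable_continuous; apply/derivable1_diffP.
Qed.

Lemma continuous_sqmod u : continuous (fun t => complex.Re (u t)) ->
  continuous (fun t => complex.Im (u t)) -> continuous (fun t => sqmod (u t)).
Proof.
move=> c1 c2 t; rewrite /continuous_at /sqmod !expr2; under eq_fun do rewrite !expr2.
apply: cvgD; apply: cvgM; [exact: c1|exact: c1|exact: c2|exact: c2].
Qed.

End velocities.

(** * Speed and length of curves *)

Section lengths.
Context (R : realType).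
Implicit Types (u w : R -> R[i]).
Local Notation mu := (@lebesgue_measure R).

Lemma fs_speed_ge0 u0 u1 t : 0 <= fs_speed u0 u1 t.
Proof. by rewrite divr_ge0 ?sqrtr_ge0// mulr_ge0 ?sqrtr_ge0// addr_ge0 ?sqmod_ge0. Qed.

Lemma fs_length_ge0 u0 u1 : 0 <= fs_length u0 u1.
Proof. by apply: Rintegral_ge0 => t _; exact: fs_speed_ge0. Qed.

Let wronskian u0 u1 t := u0 t * velocity u1 t - u1 t * velocity u0 t.

Let wronskian_continuous u0 u1 : C1_curve u0 -> C1_curve u1 ->
  continuous (fun t => complex.Re (wronskian u0 u1 t)) /\
  continuous (fun t => complex.Im (wronskian u0 u1 t)).
Proof.
have ReM (x y : R[i]) : complex.Re (x * y) = complex.Re x * complex.Re y - complex.Im x * complex.Im y by case: x => ? ?; case: y.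
have ImM (x y : R[i]) : complex.Im (x * y) = complex.Re x * complex.Im y + complex.Im x * complex.Re y by case: x => ? ?; case: y.
have ReB (x y : R[i]) : complex.Re (x - y) = complex.Re x - complex.Re y by rewrite raddfB.
have ImB (x y : R[i]) : complex.Im (x - y) = complex.Im x - complex.Im y by rewrite raddfB.
move=> /C1_curve_velocity v0 /C1_curve_velocity v1.
have [a1 a2] := has_velocity_continuous v0.
have [b1 b2] := has_velocity_continuous v1.
have [_ _ a3 a4] := v0; have [_ _ b3 b4] := v1.
rewrite /wronskian; split=> t.
- rewrite /continuous_at ReB !ReM; under eq_fun do rewrite ReB !ReM.
  by apply: cvgB; apply: cvgB; apply: cvgM; [exact: a1|exact: b3|exact: a2|exact: b4|exact: b1|exact: a3|exact: b2|exact: a4].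
- rewrite /continuous_at ImB !ImM; under eq_fun do rewrite ImB !ImM.
  by apply: cvgB; apply: cvgD; apply: cvgM; [exact: a1|exact: b4|exact: a2|exact: b3|exact: b1|exact: a4|exact: b2|exact: a3].
Qed.

Let num_continuous u0 u1 : C1_curve u0 -> C1_curve u1 ->
  continuous (fun t => Num.sqrt (sqmod (wronskian u0 u1 t))).
Proof.
move=> c0 c1 t; have [r i] := wronskian_continuous c0 c1.
apply: (@continuous_comp _ _ _ (fun t => sqmod (wronskian u0 u1 t)) Num.sqrt).
  exact: (continuous_sqmod r i).
exact: sqrt_continuous.
Qed.

Lemma continuous_sqmod2 u0 u1 : C1_curve u0 -> C1_curve u1 ->
  continuous (fun t => sqmod (u0 t) + sqmod (u1 t)).
Proof.
move=> /C1_curve_velocity/has_velocity_continuous[r0 i0].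
move=> /C1_curve_velocity/has_velocity_continuous[r1 i1] t.
by apply: cvgD; [exact: (continuous_sqmod r0 i0)|exact: (continuous_sqmod r1 i1)].
Qed.

Let den_continuous u0 u1 : C1_curve u0 -> C1_curve u1 ->
  continuous (fun t => Num.sqrt pi * (sqmod (u0 t) + sqmod (u1 t))).
Proof.
move=> c0 c1 t; apply: cvgM; first exact: cvg_cst.
exact: (continuous_sqmod2 c0 c1).
Qed.

Lemma measurable_fs_speed u0 u1 : C1_curve u0 -> C1_curve u1 ->
  measurable_fun [set: R] (fs_speed u0 u1).
Proof.
move=> c0 c1; apply: measurable_funM.
  by apply: continuous_measurable_fun; exact: num_continuous.
apply: measurable_ge0_funV.
  by apply: continuous_measurable_fun; exact: den_continuous.
by move=> t; rewrite mulr_ge0 ?sqrtr_ge0// addr_ge0 ?sqmod_ge0.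
Qed.

Lemma sqmod2_gt0 (x y : R[i]) : (0 < sqmod x + sqmod y) = ((x, y) != (0, 0)).
Proof.
rewrite xpair_eqE negb_and -!sqmod_eq0 lt_neqAle addr_ge0 ?sqmod_ge0// andbT eq_sym.
by rewrite paddr_eq0 ?sqmod_ge0// negb_and.
Qed.

Lemma integrable_fs_speed u0 u1 : C1_curve u0 -> C1_curve u1 ->
  (forall t, 0 <= t <= 1 -> (u0 t, u1 t) != (0, 0)) ->
  mu.-integrable `[0, 1] (EFin \o fs_speed u0 u1).
Proof.
move=> c0 c1 nz; apply: continuous_compact_integrable; first exact: segment_compact.
apply: continuous_in_subspaceT => t; rewrite inE/= in_itv/= => /nz.
rewrite -sqmod2_gt0 => ht; apply: cvgM; first exact: num_continuous.
apply: cvgV; first by rewrite mulf_neq0// gt_eqF// sqrtr_gt0 pi_gt0.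
exact: den_continuous.
Qed.

(** By [s = k t] the left-hand side is the integral of [g] over [[0, k]]: a curve stopped at time
    [k] is no longer than the whole. The substitution degenerates at [k = 0], which is treated
    apart. *)
Lemma le_Rintegral_scale (g : R -> R) (k : R) : 0 <= k <= 1 ->
  measurable_fun [set: R] g -> (forall t, 0 <= g t) ->
  mu.-integrable `[0, 1] (EFin \o g) ->
  \int[mu]_(t in `[0, 1]) (k * g (k * t)) <= \int[mu]_(t in `[0, 1]) g t.
Proof.
move=> /andP[k0 k1] mg g0 ig.
have fin1 : (\int[mu]_(t in `[0%R, 1%R]) (g t)%:E)%E \is a fin_num by exact: integrable_fin_num.
have mgk : measurable_fun [set: R] (fun t => g (k * t)).
  by apply: measurableT_comp => //; exact: measurable_funM.
suff le : (\int[mu]_(t in `[0%R, 1%R]) (k * g (k * t))%:E <= \int[mu]_(t in `[0%R, 1%R]) (g t)%:E)%E.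
  rewrite /Rintegral fine_le// ge0_fin_numE; first by rewrite (le_lt_trans le)// ltey_eq fin1.
  by apply: integral_ge0 => t _; rewrite lee_fin mulr_ge0.
have [->|kn0] := eqVneq k 0.
  under eq_integral do rewrite mul0r.
  by rewrite integral0; apply: integral_ge0 => t _; rewrite lee_fin.
have E (f : R -> R) : (\int[mu]_(t in `[0%R, 1%R]) (f t)%:E = \int[mu]_t (f t * \1_(`[0%R, 1%R]%classic) t)%:E)%E.
  rewrite integral_mkcond; apply: eq_integral => t _.
  by rewrite patchE indicE; case: (_ \in _); rewrite ?mulr1 ?mulr0.
have mi : measurable_fun [set: R] (fun t => (g t * \1_(`[0, 1]%classic) t)%:E).
  by apply/measurable_EFinP; apply: measurable_funM.
have mik : measurable_fun [set: R] (fun t => (g (k * t + 0) * \1_(`[0, 1]%classic) (k * t + 0))%:E).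
  by apply: (measurableT_comp mi); exact: measurable_affine.
rewrite !E (ge0_integral_affine 0 kn0 mi); last by move=> t; rewrite lee_fin mulr_ge0.
rewrite -ge0_integralZl//; last by move=> t _; rewrite lee_fin mulr_ge0.
apply: ge0_le_integral => //.
- by move=> t _; rewrite lee_fin !mulr_ge0.
- by apply/measurable_EFinP; do 2![apply: measurable_funM => //].
- exact: measurable_funeM.
move=> t _; rewrite -EFinM lee_fin ger0_norm// addr0 -!mulrA !ler_wpM2l//.
rewrite !indicE !mem_setE !in_itv/=; case: (boolP (0 <= t <= 1)) => [/andP[t0 t1]|//].
by rewrite mulr_ge0//= mulr_ile1.
Qed.

End lengths.

(** * Rotations about the centre *)

Section compression.
Context (R : realType).
Implicit Types (x y : CP1 R) (w : R[i]).

Lemma homog_eqP (w0 w1 z0 z1 : R[i]) : (w0, w1) != (0, 0) -> (z0, z1) != (0, 0) ->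
  homog w0 w1 = homog z0 z1 <-> w0 * z1 = w1 * z0.
Proof.
rewrite /homog !xpair_eqE; have [->|w00] := eqVneq w0 0; have [->|z00] := eqVneq z0 0 => //=.
- by move=> _ _; rewrite mulr0 mul0r.
- move=> w10 _; rewrite mul0r; split=> // /esym/eqP; rewrite mulf_eq0 (negbTE w10)/=.
  by rewrite (negbTE z00).
- move=> _ z10; rewrite mulr0; split=> // /eqP; rewrite mulf_eq0 (negbTE z10) orbF.
  by rewrite (negbTE w00).
- move=> _ _; split=> [[] e|e].
    by rewrite -[w1](divfK w00) e mulrAC divfK// mulrC.
  by congr Some; apply: (mulIf w00); rewrite divfK// mulrAC (mulrC z1) e mulfK.
Qed.

Lemma homog_surj x : exists2 w : R[i] * R[i], w != (0, 0) & homog w.1 w.2 = x.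
Proof.
case: x => [z|]; [exists (1, z)|exists (0, 1)].
- by rewrite xpair_eqE oner_eq0.
- by rewrite /homog oner_eq0 divr1.
- by rewrite xpair_eqE oner_eq0 andbF.
- by rewrite /homog eqxx.
Qed.

Context (a b : R[i]).
Hypothesis ab0 : 0 < sqmod a + sqmod b.
Local Notation kappa := (sqmod a + sqmod b).
(** [alpha] and [beta] are the unnormalised coordinates along the orthogonal vectors [(a, b)] and
    [(- conjc b, conjc a)]. *)
Local Notation alpha w0 w1 := (conjc a * w0 + conjc b * w1).
Local Notation beta w0 w1 := (a * w1 - b * w0).

Let kE : (kappa)%:C = a * conjc a + b * conjc b :> R[i].
Proof. by rewrite !mul_conjc rmorphD. Qed.

Lemma lagrange_identity w0 w1 :
  sqmod (alpha w0 w1) + sqmod (beta w0 w1) = kappa * (sqmod w0 + sqmod w1).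
Proof.
case: (a) (b) w0 w1 => [a1 a2] [b1 b2] [x1 x2] [y1 y2]; rewrite /sqmod/=; ring.
Qed.

Lemma sdist_homog w0 w1 : (w0, w1) != (0, 0) ->
  sdist a b (homog w0 w1) = sqmod (beta w0 w1) / (kappa * (sqmod w0 + sqmod w1)).
Proof.
move=> w00; rewrite /homog.
have k0 : kappa != 0 by rewrite gt_eqF.
have [E|w0n] := eqVneq w0 0.
  have s1 : sqmod w1 != 0 by move: w00; rewrite xpair_eqE E eqxx sqmod_eq0.
  by rewrite E /sdist mulr0 subr0 sqmod0 add0r sqmodM; field; rewrite s1 k0.
rewrite /sdist.
have s0 : sqmod w0 != 0 by rewrite sqmod_eq0.
have -> : a * (w1 / w0) - b = beta w0 w1 / w0 by field.
rewrite !sqmodM !sqmodV.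
have s2 : sqmod w0 + sqmod w1 != 0 by rewrite gt_eqF// ltr_pwDl ?sqmod_ge0// sqmod_gt0.
by field; rewrite s2 k0 s0.
Qed.

Lemma sdist_le1 x : sdist a b x <= 1.
Proof.
have [w w0 <-] := homog_surj x.
have k1 : 0 < kappa * (sqmod w.1 + sqmod w.2) by rewrite mulr_gt0// sqmod2_gt0 -surjective_pairing.
rewrite sdist_homog -?surjective_pairing// ler_pdivrMr// mul1r -lagrange_identity.
by rewrite lerDr sqmod_ge0.
Qed.

Section dilation.
Context (m n : R[i]).
Hypothesis mn : sqmod m = sqmod n.

(* The coordinates of the image of (w0, w1) under a multiple of the map with
   eigenvalues m and n on the orthogonal vectors (a, b) and (- conjc b, conjc a). *)
Definition dilation0 w0 w1 := (m * (a * conjc a) + n * (b * conjc b)) * w0 + (a * conjc b * (m - n)) * w1.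
Definition dilation1 w0 w1 := (conjc a * b * (m - n)) * w0 + (m * (b * conjc b) + n * (a * conjc a)) * w1.

Lemma dilation0E w0 w1 : dilation0 w0 w1 = a * (m * alpha w0 w1) - conjc b * (n * beta w0 w1).
Proof. by rewrite /dilation0; ring. Qed.

Lemma dilation1E w0 w1 : dilation1 w0 w1 = b * (m * alpha w0 w1) + conjc a * (n * beta w0 w1).
Proof. by rewrite /dilation1; ring. Qed.

Lemma sqmod_dilation w0 w1 :
  sqmod (dilation0 w0 w1) + sqmod (dilation1 w0 w1) = kappa ^+ 2 * sqmod m * (sqmod w0 + sqmod w1).
Proof.
transitivity (kappa * (sqmod m * sqmod (alpha w0 w1) + sqmod n * sqmod (beta w0 w1))).
  rewrite dilation0E dilation1E -!sqmodM.
  move: (m * _) (n * _) => A B.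
  by case: (a) (b) A B => [a1 a2] [b1 b2] [x1 x2] [y1 y2]; rewrite /sqmod/=; ring.
by rewrite -mn -mulrDr lagrange_identity; ring.
Qed.

(** The numerator is scaled by the modulus of the determinant, and the denominator by the factor of
    the squared norm. As [sqmod m = sqmod n], both factors are [kappa ^+ 2 * sqmod m], and only the
    time scaling [k] survives. *)
Lemma fs_speed_dilation (k : R) (u0 u1 : R -> R[i]) t : m != 0 -> 0 <= k ->
  C1_curve u0 -> C1_curve u1 ->
  fs_speed (fun s => dilation0 (u0 (k * s)) (u1 (k * s)))
           (fun s => dilation1 (u0 (k * s)) (u1 (k * s))) t = k * fs_speed u0 u1 (k * t).
Proof.
move=> m0 k0 /C1_curve_velocity h0 /C1_curve_velocity h1.
have v A B := has_velocityE (has_velocityD (has_velocityZ A (has_velocity_scale k h0))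
  (has_velocityZ B (has_velocity_scale k h1))).
rewrite /fs_speed sqmod_dilation /dilation0 /dilation1 !(v _ _).2.
set U0 := u0 _; set U1 := u1 _; set V0 := velocity u0 _; set V1 := velocity u1 _.
rewrite [X in sqmod X](_ : _ = (k * kappa ^+ 2)%:C * (m * n) * (U0 * V1 - U1 * V0)); last first.
  by rewrite rmorphM rmorphXn/= kE; ring.
rewrite !sqmodM sqmod_real -mn -expr2 -exprMn sqrtrM ?sqr_ge0// sqrtr_sqr ger0_norm; last first.
  by rewrite mulr_ge0 ?sqmod_ge0// mulr_ge0 ?sqr_ge0.
have sm0 : sqmod m != 0 by rewrite sqmod_eq0.
have kp0 : kappa != 0 by rewrite gt_eqF.
(* Where the curve meets the origin both speeds are 0, division by zero being 0. *)
have [/eqP U|U] := eqVneq (sqmod U0 + sqmod U1) 0.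
  by rewrite (eqP U) !mulr0 invr0 !mulr0.
have sp0 : Num.sqrt pi != 0 :> R by rewrite gt_eqF// sqrtr_gt0 pi_gt0.
by field; rewrite U sp0 kp0 sm0.
Qed.

Lemma dilation_neq0 w0 w1 : m != 0 -> (w0, w1) != (0, 0) ->
  (dilation0 w0 w1, dilation1 w0 w1) != (0, 0).
Proof.
move=> m0; rewrite -!sqmod2_gt0 sqmod_dilation => w00.
by rewrite !mulr_gt0 ?exprn_gt0// sqmod_gt0.
Qed.

End dilation.

(** A point is determined by the ratio of [beta] to [alpha], which the map multiplies by [n / m].
    Equal [sdist] means that the two ratios have equal modulus, so a phase correction [n / m]
    suffices. *)
Lemma dilation_to (w0 w1 z0 z1 : R[i]) : (w0, w1) != (0, 0) -> (z0, z1) != (0, 0) ->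
  sdist a b (homog w0 w1) = sdist a b (homog z0 z1) ->
  exists m n : R[i], [/\ m != 0, sqmod m = sqmod n &
    homog (dilation0 m n w0 w1) (dilation1 m n w0 w1) = homog z0 z1].
Proof.
move=> w00 z00; rewrite !sdist_homog//.
have kw : 0 < kappa * (sqmod w0 + sqmod w1) by rewrite mulr_gt0// sqmod2_gt0.
have kz : 0 < kappa * (sqmod z0 + sqmod z1) by rewrite mulr_gt0// sqmod2_gt0.
move=> /eqP; rewrite eqr_div; [|exact: lt0r_neq0|exact: lt0r_neq0] => /eqP; rewrite -!lagrange_identity => e.
have key m n : m * (alpha w0 w1 * beta z0 z1) = n * (beta w0 w1 * alpha z0 z1) ->
    dilation0 m n w0 w1 * z1 = dilation1 m n w0 w1 * z0.
  move=> e'; apply/eqP; rewrite -subr_eq0.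
  rewrite (_ : _ - _ = m * (alpha w0 w1 * beta z0 z1) - n * (beta w0 w1 * alpha z0 z1)).
    by rewrite e' subrr.
  by rewrite dilation0E dilation1E; ring.
suff : exists m n : R[i], [/\ m != 0, sqmod m = sqmod n &
    m * (alpha w0 w1 * beta z0 z1) = n * (beta w0 w1 * alpha z0 z1)].
  move=> [m [n [m0 mn e']]]; exists m, n; split=> //.
  by apply/homog_eqP; [exact: dilation_neq0|exact: z00|exact: key].
move: (alpha w0 w1) (beta w0 w1) (alpha z0 z1) (beta z0 z1) e => A B A' B' e.
have e2 : sqmod (B * A') = sqmod (A * B').
  by rewrite !sqmodM; apply/eqP; rewrite -subr_eq0; apply/eqP; rewrite -[RHS](subrr (sqmod B' * (sqmod A + sqmod B))) -[X in _ = X - _]e; ring.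
(* If one cross product vanishes, so does the other: both points are the centre or both its
   antipode, and the identity works. Otherwise the cross products themselves serve as [m] and
   [n]. *)
have [BA|BA] := eqVneq (B * A') 0.
  exists 1, 1; split; rewrite ?oner_eq0// !mul1r BA; apply/eqP.
  by rewrite -sqmod_eq0 -e2 BA sqmod0.
exists (B * A'), (A * B'); split=> //; ring.
Qed.

End compression.

(** * Monotonicity of the distance to the centre *)

Section distance.
Context (R : realType) (a b : R[i]).
Hypothesis ab0 : 0 < sqmod a + sqmod b.
Local Notation kappa := (sqmod a + sqmod b).
Local Notation c := (homog a b).
Implicit Types (x y : CP1 R).

Lemma sdist_center : sdist a b c = 0.
Proof. by rewrite sdist_homog -?sqmod2_gt0// (mulrC b a) subrr sqmod0 mul0r. Qed.

(** The homogeneous formula has no exceptional point, so continuity holds even where the curve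
    passes through infinity. *)
Lemma sdist_curve_continuous (u0 u1 : R -> R[i]) : C1_curve u0 -> C1_curve u1 ->
  (forall t, 0 <= t <= 1 -> (u0 t, u1 t) != (0, 0)) ->
  {within `[0, 1], continuous (fun t => sdist a b (homog (u0 t) (u1 t)))}.
Proof.
move=> c0 c1 nz.
apply: (@subspace_eq_continuous _ _ _
  (fun t => sqmod (a * u1 t - b * u0 t) / (kappa * (sqmod (u0 t) + sqmod (u1 t))))).
  by move=> t; rewrite inE/= in_itv/= => /nz t0; apply/esym; exact: sdist_homog.
have h0 := C1_curve_velocity c0; have h1 := C1_curve_velocity c1.
have [r i] := has_velocity_continuous (has_velocityD (has_velocityZ a h1) (has_velocityZ (- b) h0)).
apply: continuous_in_subspaceT => t; rewrite inE/= in_itv/= => /nz.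
rewrite -sqmod2_gt0 => ht; apply: cvgM.
  under eq_fun do rewrite -mulNr; rewrite -mulNr.
  exact: (continuous_sqmod r i).
apply: cvgV; first by rewrite mulf_neq0// gt_eqF.
apply: cvgM; first exact: cvg_cst.
exact: continuous_sqmod2.
Qed.

Lemma compressed_curve x y (u0 u1 : R -> R[i]) : sdist a b y <= sdist a b x ->
  curve_from_to c x u0 u1 ->
  exists v0 v1, curve_from_to c y v0 v1 /\ fs_length v0 v1 <= fs_length u0 u1.
Proof.
move=> yx [c0 c1 nz e0 e1].
have sd0 z : 0 <= sdist a b z.
  by case: z => [z|]; rewrite /sdist divr_ge0 ?sqmod_ge0 ?(ltW ab0)// mulr_ge0 ?(ltW ab0)// addr_ge0 ?sqmod_ge0.
have [t0 t01 st0] : exists2 t0, t0 \in `[0, 1] & sdist a b (homog (u0 t0) (u1 t0)) = sdist a b y.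
  apply: IVT => //; first exact: sdist_curve_continuous.
  by rewrite e0 e1 sdist_center min_l ?sd0// max_r ?sd0//= sd0.
move: t01; rewrite in_itv/= => t01; have /andP[t00 t0_1] := t01.
have [w w0 wy] := homog_surj y.
have [m [n [m0 mn e]]] := dilation_to ab0 (nz _ t01) w0 (etrans st0 (congr1 _ (esym wy))).
have h0 := C1_curve_velocity c0; have h1 := C1_curve_velocity c1.
have cv A B := (has_velocityE (has_velocityD (has_velocityZ A (has_velocity_scale t0 h0))
  (has_velocityZ B (has_velocity_scale t0 h1)))).1.
exists (fun t => dilation0 a b m n (u0 (t0 * t)) (u1 (t0 * t))),
       (fun t => dilation1 a b m n (u0 (t0 * t)) (u1 (t0 * t))); split; last first.
  rewrite /fs_length; under eq_Rintegral do rewrite (fs_speed_dilation ab0 mn)//.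
  apply: le_Rintegral_scale => //; first exact: measurable_fs_speed.
    by move=> t; exact: fs_speed_ge0.
  exact: integrable_fs_speed.
split; [exact: cv|exact: cv| | |].
- move=> t /andP[tge0 tle1]; apply: dilation_neq0 => //; apply: nz.
  by rewrite mulr_ge0//= mulr_ile1.
(* The centre is an eigenline of the rotation, so the new curve still starts there. *)
- have z01 : 0 <= (0 : R) <= 1 by rewrite lexx ler01.
  have ab00 : (a, b) != (0, 0) by rewrite -sqmod2_gt0.
  rewrite mulr0; apply/homog_eqP => //; first by apply: dilation_neq0 => //; exact: nz.
  have /homog_eqP : homog (u0 0) (u1 0) = homog a b by [].
  move=> /(_ (nz _ z01) ab00) E.
  by rewrite /dilation0 /dilation1; ring: E.
- by rewrite mulr1 e.
Qed.

(** Ensures that the infimum defining the distance is over a non-empty set. The curve is the segment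
    in C^2 between representatives, or a constant when they are proportional. *)
Lemma curve_exists x : exists u0 u1, curve_from_to c x u0 u1.
Proof.
have [w w0 <-] := homog_surj x; case: w w0 => [w0 w1] /= w00.
have ab00 : (a, b) != (0, 0) by rewrite -sqmod2_gt0.
have [E|E] := eqVneq (a * w1) (b * w0).
  exists (fun=> a), (fun=> b); split=> //; try exact: (has_velocityE (has_velocity_cst _)).1.
  by apply/homog_eqP.
have cv A B := (has_velocityE (has_velocityD (has_velocity_cst A)
  (has_velocityZ B (has_velocity_id R)))).1.
exists (fun t => a + (w0 - a) * t%:C), (fun t => b + (w1 - b) * t%:C).
split; [exact: cv|exact: cv| | |].
(* The determinant of [(a, b)] with the point at time [t] is [t (a w1 - b w0)]; it vanishes only at
   [t = 0], where the point is [(a, b)] itself. *)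
- move=> t _; apply: contra_neq E => -[E0 E1].
  have : t%:C * (a * w1 - b * w0) = 0.
    transitivity (a * (b + (w1 - b) * t%:C) - b * (a + (w0 - a) * t%:C)); first by ring.
    by rewrite E0 E1 !mulr0 subrr.
  move=> /eqP; rewrite mulf_eq0 subr_eq0 => /orP[/eqP t0|/eqP//].
  by move: ab00 E0 E1; rewrite t0 !mulr0 !addr0 => + E0 E1; rewrite E0 E1 eqxx.
- by rewrite !mulr0 !addr0.
- by rewrite !mulr1 [a + _]addrC [b + _]addrC !subrK.
Qed.

Lemma le_fs_dist x y : sdist a b y <= sdist a b x -> fs_dist c y <= fs_dist c x.
Proof.
move=> yx; apply: lb_le_inf.
  by have [u0 [u1 cu]] := curve_exists x; exists (fs_length u0 u1), u0, u1.
move=> _ [u0 [u1 [cu ->]]].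
have [v0 [v1 [cv le]]] := compressed_curve yx cu.
apply: le_trans le; apply: ge_inf; last by exists v0, v1.
by exists 0 => _ [z0 [z1 [_ ->]]]; exact: fs_length_ge0.
Qed.

End distance.

(** * Geodesic balls as sublevel sets of the angle *)

Section ball_profile.
Context (R : realType) (B : set (CP1 R)).

Lemma geodesic_ball_profile : geodesic_ball B -> 0 < fs_vol B ->
  exists (a b : R[i]) (J : set R) (v : R),
  [/\ 0 < sqmod a + sqmod b, measurable J, 0 < v <= 1 &
      [/\ forall s, 0 <= s < v -> J s, forall s, J s -> s <= v &
          forall x, B x <-> J (sdist a b x)]].
Proof.
move=> [c [r [_ BE]]] vol0.
have [[a b] ab00 /= cE] := homog_surj c.
have ab0 : 0 < sqmod a + sqmod b by rewrite sqmod2_gt0.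
(* Taking the downward closure of the values of [sdist] on [B] makes [J] an interval, hence
   measurable, without expressing the radius in terms of [sdist]. *)
pose J : set R := [set s | exists2 x, B x & s <= sdist a b x].
have JB x : B x <-> J (sdist a b x).
  split=> [Bx|[y By xy]]; first by exists x.
  move: By; rewrite BE/= -cE; exact/le_lt_trans/le_fs_dist.
have Jdown s t : t <= s -> J s -> J t.
  by move=> ts [x Bx sx]; exists x => //; exact: le_trans sx.
have mJ : measurable J.
  by apply: is_interval_measurable => s t _ Jt z /andP[_ zt]; exact: Jdown Jt.
have J1 : ubound J 1 by move=> s [x _ sx]; rewrite (le_trans sx)// sdist_le1.
have J0 : J !=set0.
  apply: contrapT => /set0P/negP/negPn/eqP J0; move: vol0.
  rewrite /fs_vol (_ : (fun z => _) = fun=> 0); first by rewrite fs_int_cst ltxx.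
  apply/funext => z; rewrite indicE memNset// => /JB.
  by rewrite J0.
have supJ : has_sup J by split=> //; exists 1.
exists a, b, J, (sup J); split=> //; last first.
  split=> // s.
    move=> /andP[_ sv]; have [|t Jt] := @sup_adherent R J (sup J - s) _ supJ.
      by rewrite subr_gt0.
    by rewrite opprB addrC subrK => /ltW st; exact: Jdown Jt.
  exact: sup_upper_bound.
(* If [sup J <= 0], then in the chart [B] contains at most the point [b / a], contrary to its
   positive volume. *)
rewrite ge_sup// andbT ltNge; apply/negP => sup_le0; move: vol0.
suff -> : fs_vol B = 0 by rewrite ltxx.
rewrite -[RHS](fs_int_cst 0); apply: (eq_fs_int_point (z0 := b / a)).
- by have [] := bmeasurable_ball ab0 mJ JB.
- by [].
move=> z zba; rewrite indicE memNset// => /JB.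
move=> /(sup_upper_bound supJ) sz.
have := le_trans sz sup_le0; rewrite /sdist pmulr_lle0; last first.
  by rewrite invr_gt0 mulr_gt0// ltr_pwDl ?sqmod_ge0.
rewrite leNgt sqmod_gt0 negbK subr_eq0 => /eqP az.
have [a0|a0] := eqVneq a 0.
  by move: az ab00; rewrite a0 mul0r => <-; rewrite eqxx.
by move/eqP: zba; apply; rewrite -az mulrC mulKf.
Qed.

End ball_profile.

Theorem corollary5p22 (R : realType) (B : set (CP1 R))
    (hB : geodesic_ball B) (hvol : 0 < fs_vol B <= 1) :
  (forall p : nat, (0 < p)%N ->
     is_min (spec (@toeplitz R p (fun x => (\1_B x)%:C)))
            ((fs_vol B ^+ p.+1)%:C)) /\
  (fs_vol B < 1 ->
   forall m : nat -> R,
     (forall p : nat, (0 < p)%N ->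
        is_min (spec (@toeplitz R p (fun x => (\1_B x)%:C))) ((m p)%:C)) ->
     exp_decay m).
Proof.
have /andP[vol0 _] := hvol.
have [a [b [J [v [ab0 mJ v01 [J1 J2 BJ]]]]]] := geodesic_ball_profile hB vol0.
have volE : fs_vol B = v := fs_vol_ball ab0 mJ v01 J1 J2 BJ.
have min_spec p := ball_spec_is_min ab0 mJ v01 J1 J2 BJ p.
rewrite volE in vol0 *; split=> [p _|v1 m hm]; first exact: min_spec.
(* The decay is read off from [v ^+ p.+1 <= v ^+ p], where [v ^+ p] is the exponential of
   [p * ln v]. *)
exists 1, (- ln v); split=> //; first by rewrite oppr_gt0 ln_lt0// vol0.
move=> p p0; have [Sm lem] := hm p p0; have [Sv lev] := min_spec p.
(* A minimum is unique by antisymmetry of the order. *)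
have -> : m p = v ^+ p.+1.
  by apply: complexI; apply: le_anti; rewrite lem//= lev.
rewrite mul1r ger0_norm ?exprn_ge0 ?(ltW vol0)// mulNr opprK mulrC.
rewrite expRM_natl lnK// exprS ler_piMl ?exprn_ge0// ltW//.
Qed.
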